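(* Let $k_0>0$ be a constant satisfying the nonlinear interpolation inequality (N) stated in the context. For $0<k<k_0$ define $$\mathbf{m}_k:=\inf\Big\{\int_{\mathbb{R}}\big(W(f)-k(f')^2+(f'')^2\big)\,dx\colon f\in\mathcal{A}\Big\}.$$ Then, for every $0<k<k_0$, the constant $\mathbf{m}_k$ is positive and $$\mathbf{m}_k=\min\Big\{\int_{\mathbb{R}}\big(W(f)-k(f')^2+(f'')^2\big)\,dx\colon f\in W^{2,2}_{\rm loc}(\mathbb{R}),\ \lim_{x\to-\infty}f(x)=-1,\ \lim_{x\to+\infty}f(x)=1\Big\},$$ where in particular the minimum on the right-hand side is attained.
   Context: Standing assumptions on $W$: $W\colon\mathbb{R}\to[0,+\infty)$ is continuous, $W^{-1}(\{0\})=\{-1,1\}$, and there exists $c>0$ such that $W(s)\ge c\,(s-1)^2$ for all $s\ge0$ and $W(s)\ge c\,(s+1)^2$ for all $s\le 0$. The class $\mathcal{A}$ is $$\mathcal{A}:=\{f\in W^{2,2}_{\rm loc}(\mathbb{R})\colon f(x)=1 \text{ if } x>T,\ f(x)=-1 \text{ if } x<-T,\ \text{for some } T>0\}.$$ Inequality (N): the constant $k_0>0$ (which exists for such $W$) satisfies, for every $a<b$ and every $u\in W^{2,2}(a,b)$, $$k_0\int_a^b (u')^2\,dx \leq \frac{1}{(b-a)^2}\int_a^b W(u)\,dx+(b-a)^2\int_a^b(u'')^2\,dx.$$ Convention: for $f\in W^{2,2}_{\rm loc}(\mathbb{R})$ with $\int_{\mathbb{R}}(W(f)+(f'')^2)\,dx=+\infty$,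 the integral $\int_{\mathbb{R}}(W(f)-k(f')^2+(f'')^2)\,dx$ is understood to be $+\infty$. *)

(* Defs.v *)
From HB Require Import structures.
From mathcomp Require Import all_boot all_order all_algebra.
From mathcomp Require Import all_classical all_reals all_analysis.

Set Implicit Arguments.
Unset Strict Implicit.
Unset Printing Implicit Defensive.

Import Order.TTheory GRing.Theory Num.Theory.
Import numFieldNormedType.Exports.

Local Open Scope classical_set_scope.
Local Open Scope ring_scope.

Section Sobolev.
Context {R : realType}.
Implicit Types (a b : R) (u v phi : R -> R).

Local Notation mu := (@lebesgue_measure R).

Definition L2_on a b u : Prop :=
  measurable_fun `]a, b[ u /\
  mu.-integrable `]a, b[ (fun x => (u x ^+ 2)%:E).

(* C^1_c(a, b); functions on ]a, b[ with compact support are extended by 0. *)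
Definition C1c a b phi : Prop :=
  [/\ forall x, derivable phi x 1,
      continuous (derive1 phi) &
      exists K : set R, [/\ compact K, K `<=` `]a, b[ &
        forall x, ~ K x -> phi x = 0]].

(* Weak derivatives are tested on C^1_c(a, b), as in Brezis, "Functional
   Analysis, Sobolev Spaces and PDEs", Section 8.2; for locally integrable
   functions this is the same as testing on smooth functions. *)
Definition weak_derivative a b u v : Prop :=
  forall phi, C1c a b phi ->
    \int[mu]_(x in `]a, b[) (u x * derive1 phi x) =
    - \int[mu]_(x in `]a, b[) (v x * phi x).

(* u \in W^{2,2}(a, b) with u' = u1 and u'' = u2. Weak derivatives are unique
   only up to null sets, so they are carried along as data: W22 a b u is
   non-empty exactly when u is in W^{2,2}(a, b), and all its elements agree
   almost everywhere on ]a, b[. *)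
Definition W22 a b u : set ((R -> R) * (R -> R)) :=
  [set d | [/\ L2_on a b u, L2_on a b d.1, L2_on a b d.2,
               weak_derivative a b u d.1 & weak_derivative a b d.1 d.2]].

(* As usual in one dimension, an element of W^{2,2}_loc(R) is identified with
   its continuous representative, so that pointwise values and limits make
   sense. *)
Definition W22loc u : set ((R -> R) * (R -> R)) :=
  [set d | continuous u /\ forall a b, a < b -> W22 a b u d].

End Sobolev.

Section Energy.
Context {R : realType}.
Implicit Types (W f : R -> R) (k : R).

Local Notation mu := (@lebesgue_measure R).

Definition double_well W : Prop :=
  [/\ continuous W,
      forall s, 0 <= W s,
      W @^-1` [set 0] = [set -1; 1] &
      exists2 c : R, 0 < c &
        (forall s, 0 <= s -> c * (s - 1) ^+ 2 <= W s) /\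
        (forall s, s <= 0 -> c * (s + 1) ^+ 2 <= W s)].

Definition interpolation_ineq W (k0 : R) : Prop :=
  forall (a b : R) (u u1 u2 : R -> R), a < b -> W22 a b u (u1, u2) ->
    (k0%:E * \int[mu]_(x in `]a, b[) (u1 x ^+ 2)%:E <=
     ((b - a) ^- 2)%:E * \int[mu]_(x in `]a, b[) (W (u x))%:E +
     ((b - a) ^+ 2)%:E * \int[mu]_(x in `]a, b[) (u2 x ^+ 2)%:E)%E.

Definition energy W k f (f1 f2 : R -> R) : \bar R :=
  (if \int[mu]_x (W (f x) + f2 x ^+ 2)%:E == +oo then +oo
   else \int[mu]_x (W (f x) - k * f1 x ^+ 2 + f2 x ^+ 2)%:E)%E.

Definition eventually_pm1 f : Prop :=
  exists2 T : R, 0 < T &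
    (forall x, T < x -> f x = 1) /\ (forall x, x < - T -> f x = -1).

Definition limits_pm1 f : Prop :=
  f x @[x --> -oo] --> (-1 : R) /\ f x @[x --> +oo] --> (1 : R).

(* Energies of the functions of W^{2,2}_loc(R) satisfying P. *)
Definition energies W k (P : (R -> R) -> Prop) : set (\bar R) :=
  [set e | exists f f1 f2,
     [/\ W22loc f (f1, f2), P f & e = energy W k f f1 f2]].

Definition m_ W k : \bar R := ereal_inf (energies W k eventually_pm1).

Definition is_minimum (S : set (\bar R)) (m : \bar R) : Prop :=
  S m /\ lbound S m.

End Energy.

(* Main.v *)
From HB Require Import structures.
From mathcomp Require Import all_boot all_order all_algebra.
From mathcomp Require Import all_classical all_reals all_analysis.
From mathcomp Require Import measurable_realfun ring lra.
Require Import Defs.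

Set Implicit Arguments.
Unset Strict Implicit.
Unset Printing Implicit Defensive.

Import Order.TTheory GRing.Theory Num.Theory.
Import numFieldNormedType.Exports.

Local Open Scope classical_set_scope.
Local Open Scope ring_scope.

(** The proof is the direct method of the calculus of variations, run on
    functions f of class C^1 whose derivative g is a primitive of a locally
    square integrable h; this is the predicate [H2 f g h].  By the
    du Bois-Reymond lemma these are exactly the functions of W^{2,2}_loc with
    their weak derivatives, up to null sets ([W22loc_H2], [H2_W22loc]).

    Everything rests on the energy of f on compact intervals.  Inequality (N)
    on intervals of length 1, summed up, bounds the energy on an interval of
    integer length from below by (1 - k / k0) times the integral of
    W(f) + h^2 ([E_ge_density]).  Consequently the energy of an interval never
    exceeds that of a longer one obtained by adding integer lengths on both
    sides, and never exceeds the total energy ([energy_ge]); conversely the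
    total energy is bounded by any bound valid on all large symmetric
    intervals ([energy_le]).  All comparisons thus take place between real
    numbers.

    Positivity: by (N) and the Cauchy-Schwarz inequality, on the unit interval
    to the right of a zero of f either f'' is large or f stays away from the
    wells, so that the integral of W(f) + h^2 there has a positive lower bound
    ([zero_cost]).

    Lower bound: two functions with the same value and the same slope at a
    point can be glued there, and a cubic polynomial joins two states close to
    (1, 0) or to (-1, 0) at a small cost ([bridge]).  So if (f, f') is close to
    (-1, 0) at s and to (1, 0) at t, then the energy of f on [s, t] is at least
    m_k - eps ([m_le_near_wells]).  A function with limits -1 and 1 has such
    points s and t, by the mean value theorem.

    Attainment: a minimizing sequence in the class A is translated so that its
    last zero is the origin.  The energy bound controls f'' in L^2, hence f' in
    C^{1/2} and, through (N), in L^oo; Arzela-Ascoli gives a subsequence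
    converging locally uniformly together with the first derivatives.  The
    second derivatives even converge strongly in L^2_loc: replacing on [-T, T]
    two almost minimizers f and u by (f + u) / 2 plus or minus a small cubic
    correction cannot lower the energy much, and the parallelogram identity
    turns this into smallness of the integral of (f'' - u'')^2
    ([near_minimal_close]).  Hence the limit v has energy at most m_k.  Finite
    energy forces |v| to tend to 1 at both ends.  Since v >= 0 on the right
    half-line, the limit at +oo is 1.  If v also tended to 1 at -oo, the
    sequence would already have spent almost m_k on a transition far to the
    left and would still have to pay for its zero at the origin, which is
    impossible ([not_left_one]). *)

(** * Integrals over compact intervals *)

Section LocalIntegral.
Context {R : realType}.
Implicit Types (a b c : R) (u v : R -> R).
Local Notation mu := (@lebesgue_measure R).

Definition locint u := forall a b, mu.-integrable `[a, b] (EFin \o u).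

Definition Int a b u : R := \int[mu]_(x in `[a, b]) u x.

Lemma locint_cont u : continuous u -> locint u.
Proof.
move=> cu a b; apply: continuous_compact_integrable; first exact: segment_compact.
exact: continuous_subspaceT.
Qed.

Lemma locint_cst c : locint (fun=> c).
Proof. by apply: locint_cont => x; exact: cvg_cst. Qed.

Lemma locintD u v : locint u -> locint v -> locint (fun x => u x + v x).
Proof.
move=> lu lv a b.
rewrite (_ : _ \o _ = (EFin \o u) \+ (EFin \o v))%E; last exact/funext.
exact: integrableD.
Qed.

Lemma locintZ k u : locint u -> locint (fun x => k * u x).
Proof.
move=> lu a b.
rewrite (_ : _ \o _ = (fun x => k%:E * (EFin \o u) x)%E); last exact/funext.
exact: integrableZl.
Qed.

Lemma locintN u : locint u -> locint (fun x => - u x).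
Proof.
move=> /(locintZ (-1)).
by under [X in locint X -> _]funext do rewrite mulN1r.
Qed.

Lemma locintB u v : locint u -> locint v -> locint (fun x => u x - v x).
Proof. by move=> lu /locintN; exact: locintD. Qed.

Lemma locint_norm u : locint u -> locint (fun x => `|u x|).
Proof.
move=> lu a b.
rewrite (_ : _ \o _ = abse \o (EFin \o u)); last exact/funext.
exact: integrable_abse.
Qed.

Lemma bigcup_itvcc : \bigcup_n `[- n%:R, n%:R]%classic = [set: R].
Proof.
apply/seteqP; split => // x _.
exists (Num.truncn `|x|).+1 => //=; rewrite in_itv/= -ler_norml ltW//.
exact: truncnS_gt.
Qed.

Lemma measurable_locint u : locint u -> measurable_fun setT u.
Proof.
move=> lu; rewrite -bigcup_itvcc; apply/measurable_fun_bigcup => // n.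
by have /measurable_int/measurable_EFinP := lu (- n%:R) n%:R.
Qed.

Lemma le_locint u v : measurable_fun setT u -> locint v ->
  (forall x, `|u x| <= v x) -> locint u.
Proof.
move=> mu_ lv uv a b; apply: le_integrable (lv a b) => //.
- by apply/measurable_EFinP; exact: measurable_funTS.
- by move=> x _ /=; rewrite lee_fin (le_trans (uv x))// ler_norm.
Qed.

Lemma IntD a b u v : locint u -> locint v ->
  Int a b (fun x => u x + v x) = Int a b u + Int a b v.
Proof. by move=> lu lv; rewrite /Int RintegralD. Qed.

Lemma IntB a b u v : locint u -> locint v ->
  Int a b (fun x => u x - v x) = Int a b u - Int a b v.
Proof. by move=> lu lv; rewrite /Int RintegralB. Qed.

Lemma IntZ a b k u : locint u -> Int a b (fun x => k * u x) = k * Int a b u.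
Proof. by move=> lu; rewrite /Int RintegralZl. Qed.

Lemma Int_cst a b c : a <= b -> Int a b (fun=> c) = c * (b - a).
Proof.
move=> ab; rewrite /Int Rintegral_cst//= lebesgue_measure_itv/= lte_fin.
by case: ltgtP ab => [|//|->] _; rewrite /= ?subrr ?mulr0.
Qed.

Lemma eq_Int a b u v : (forall x, a <= x <= b -> u x = v x) ->
  Int a b u = Int a b v.
Proof. by move=> uv; apply: eq_Rintegral => x; rewrite inE/= in_itv/= => /uv. Qed.

Lemma le_Int a b u v : locint u -> locint v ->
  (forall x, a <= x <= b -> u x <= v x) -> Int a b u <= Int a b v.
Proof.
by move=> lu lv uv; apply: le_Rintegral => // x; rewrite /= in_itv/= => /uv.
Qed.

Lemma Int_ge0 a b u : (forall x, a <= x <= b -> 0 <= u x) -> 0 <= Int a b u.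
Proof. by move=> u0; apply: Rintegral_ge0 => x; rewrite /= in_itv/= => /u0. Qed.

Lemma Int_split b a c u : locint u -> a <= b -> b <= c ->
  Int a c u = Int a b u + Int b c u.
Proof.
move=> lu ab bc.
have := @Rintegral_itvB R u (BLeft a) (BRight c) b (lu a c).
rewrite !bnd_simp => /(_ ab bc).
rewrite Rintegral_itv_obnd_cbnd//; last first.
  by apply: integrableS (lu b c) => //; exact: subset_itv_oc_cc.
by move=> /eqP; rewrite subr_eq addrC => /eqP.
Qed.

Lemma Int_refl a u : Int a a u = 0.
Proof. by rewrite /Int set_itv1 Rintegral_set1. Qed.

Lemma le_Int_itv a b c d u : locint u -> (forall x, 0 <= u x) ->
  a <= c -> c <= d -> d <= b -> Int c d u <= Int a b u.
Proof.
move=> lu u0 ac cd db.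
rewrite (@Int_split c a b)// ?(le_trans cd)// (@Int_split d c b)//.
have : 0 <= Int a c u by apply: Int_ge0.
have : 0 <= Int d b u by apply: Int_ge0.
lra.
Qed.

Lemma le_norm_Int a b u : locint u -> `|Int a b u| <= Int a b (fun x => `|u x|).
Proof. by move=> lu; exact: le_normr_Rintegral. Qed.

Lemma Int_le_cst a b M u : a <= b -> locint u ->
  (forall x, a <= x <= b -> u x <= M) -> Int a b u <= M * (b - a).
Proof.
by move=> ab lu uM; rewrite -Int_cst//; apply: le_Int => //; exact: locint_cst.
Qed.

Lemma Int_ge_cst a b M u : a <= b -> locint u ->
  (forall x, a <= x <= b -> M <= u x) -> M * (b - a) <= Int a b u.
Proof.
by move=> ab lu uM; rewrite -Int_cst//; apply: le_Int => //; exact: locint_cst.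
Qed.

Lemma is_derive_cont u v : (forall x : R, is_derive x 1 u (v x)) -> continuous u.
Proof.
move=> duv x; apply: differentiable_continuous.
by apply/derivable1_diffP; have [] := duv x.
Qed.

Lemma FTC a b u v : a <= b -> continuous v ->
  (forall x : R, is_derive x 1 u (v x)) -> Int a b v = u b - u a.
Proof.
rewrite le_eqVlt => /predU1P[-> _ _|ab cv duv]; first by rewrite Int_refl subrr.
have cu := is_derive_cont duv.
rewrite /Int /Rintegral (@continuous_FTC2 _ v u)//.
- exact: continuous_subspaceT.
- split.
  + by move=> x _; have [] := duv x.
  + by apply: cvg_at_right_filter; exact: cu.
  + by apply: cvg_at_left_filter; exact: cu.
- by move=> x _; rewrite derive1E; have [] := duv x.
Qed.

(** The case split makes [primB] hold for all bounds, because the integral over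
    `[x, 0] is 0 instead of negative when 0 < x. *)
Definition prim u x := if 0 <= x then Int 0 x u else - Int x 0 u.

Lemma primB u a b : locint u -> a <= b -> prim u b - prim u a = Int a b u.
Proof.
move=> lu ab; rewrite /prim; case: (leP 0 a) => a0.
  by rewrite (le_trans a0 ab) (@Int_split a 0 b)//; ring.
case: (leP 0 b) => b0; first by rewrite (@Int_split 0 a b)//; [ring|exact: ltW].
rewrite (@Int_split b a 0)//; [ring|exact: ltW].
Qed.

Lemma is_derive_prim u (x : R) : continuous u -> is_derive x 1 (prim u) (u x).
Proof.
move=> cu; have lu := locint_cont cu.
pose y := x - 1.
have yx : y < x by rewrite /y; lra.
have [||||D1 D2] := @continuous_FTC1_closed R u y x (x + 1).
- by rewrite ltrDl.
- exact: lu.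
- exact: yx.
- exact: cu.
pose F := fun z => Int y z u.
have E : {near x, F \+ cst (prim u y) =1 prim u}.
  near=> z; rewrite /F /= -primB//; first by rewrite subrK.
  near: z; exact: lt_le_nbhsr.
have dF : is_derive x 1 F (u x).
  by apply: DeriveDef; [exact: D1|rewrite -derive1E; exact: D2].
have dF2 : is_derive x 1 (F \+ cst (prim u y)) (u x).
  by apply: is_derive_eq; rewrite addr0.
by apply: near_eq_is_derive dF2 => //; near do rewrite -E.
Unshelve. all: by end_near. Qed.

End LocalIntegral.

(** * Locally square integrable functions *)

Section L2Local.
Context {R : realType}.
Implicit Types (a b c : R) (u v h k : R -> R).
Local Notation mu := (@lebesgue_measure R).

Definition L2loc h := measurable_fun setT h /\ locint (fun x => h x ^+ 2).

Lemma L2loc_cont h : continuous h -> L2loc h.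
Proof.
move=> ch; split; first exact: continuous_measurable_fun.
by apply: locint_cont => x; apply: cvgM; exact: ch.
Qed.

Lemma L2locM h k : L2loc h -> L2loc k -> locint (fun x => h x * k x).
Proof.
move=> [mh lh] [mk lk]; apply: le_locint (locintD lh lk) _.
  exact: measurable_funM.
by move=> x; rewrite ler_norml; nra.
Qed.

Lemma L2loc_locint h : L2loc h -> locint h.
Proof.
move=> lh; have := L2locM lh (L2loc_cont (@cst_continuous R R 1)).
by under [X in locint X -> _]funext do rewrite mulr1.
Qed.

Lemma L2locD h k : L2loc h -> L2loc k -> L2loc (fun x => h x + k x).
Proof.
move=> lh lk; split; first by apply: measurable_funD; [case: lh|case: lk].
have -> : (fun x => (h x + k x) ^+ 2) =
    (fun x => h x ^+ 2 + (2 * (h x * k x) + k x ^+ 2)).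
  by apply/funext => x; ring.
by apply: locintD; [case: lh|apply: locintD; [exact/locintZ/L2locM|case: lk]].
Qed.

Lemma L2locZ c h : L2loc h -> L2loc (fun x => c * h x).
Proof.
move=> [mh lh]; split; first exact: measurable_funM.
under [X in locint X]funext do rewrite exprMn.
exact: locintZ.
Qed.

Lemma L2locB h k : L2loc h -> L2loc k -> L2loc (fun x => h x - k x).
Proof.
move=> lh /(L2locZ (-1)) /(L2locD lh).
by under [X in L2loc X -> _]funext do rewrite mulN1r.
Qed.

(** The square of the difference of h with its mean value has a nonnegative
    integral. *)
Lemma Cauchy_Schwarz a b h : a <= b -> L2loc h ->
  Int a b h ^+ 2 <= (b - a) * Int a b (fun x => h x ^+ 2).
Proof.
rewrite le_eqVlt => /predU1P[-> _|ab lh].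
  by rewrite Int_refl subrr expr2 mulr0 mul0r.
have li := L2loc_locint lh; have ba : 0 < b - a by rewrite subr_gt0.
set S := Int a b h; set Q := Int a b _.
have : 0 <= Int a b (fun x => h x ^+ 2 + (- (2 * (S / (b - a))) * h x +
    (S / (b - a)) ^+ 2)).
  apply: Int_ge0 => x _.
  rewrite (_ : _ + _ = (h x - S / (b - a)) ^+ 2) ?sqr_ge0//; ring.
have l1 : locint (fun x => - (2 * (S / (b - a))) * h x) by exact: locintZ.
have l2 : locint (fun=> (S / (b - a)) ^+ 2) by exact: locint_cst.
have l3 : locint (fun x => h x ^+ 2) by case: lh.
rewrite (IntD _ _ l3 (locintD l1 l2)) (IntD _ _ l1 l2) IntZ// (Int_cst _ (ltW ab)).
rewrite -/S -/Q (_ : _ + _ = Q - S ^+ 2 / (b - a)); last by field; rewrite gt_eqF.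
by rewrite subr_ge0 ler_pdivrMr// mulrC.
Qed.

Lemma Int_sqrD_le a b t h k : a <= b -> 0 < t -> L2loc h -> L2loc k ->
  Int a b (fun x => (h x + k x) ^+ 2) <=
  (1 + t) * Int a b (fun x => h x ^+ 2) + (1 + t^-1) * Int a b (fun x => k x ^+ 2).
Proof.
move=> ab t0 lh lk; have [_ lh2] := lh; have [_ lk2] := lk.
rewrite -!IntZ// -IntD; [|exact: locintZ..].
apply: le_Int; first by case: (L2locD lh lk).
  by apply: locintD; exact: locintZ.
move=> x _; rewrite -subr_ge0.
rewrite (_ : _ - _ = t^-1 * (t * h x - k x) ^+ 2); last by field; rewrite gt_eqF.
by rewrite mulr_ge0 ?sqr_ge0// invr_ge0 ltW.
Qed.

End L2Local.

Section Translation.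
Context {R : realType}.
Implicit Types (a b c : R) (u : R -> R).
Local Notation mu := (@lebesgue_measure R).

Let shift c : measurableTypeR R -> measurableTypeR R := fun x => x + c.

Let measurable_shift c : measurable_fun setT (shift c).
Proof. exact: measurable_funD. Qed.

Let lebesgue_measure_shift c (A : set (measurableTypeR R)) : measurable A ->
  mu A = pushforward mu (shift c) A.
Proof.
apply: lebesgue_measure_unique => _ [[x y] _ <-].
pose B := shift c @^-1` `]x, y]%classic.
transitivity (mu B); last by [].
have -> : B = `](x - c), (y - c)]%classic.
  by apply/seteqP; split => z; rewrite /B/= !in_itv/= /shift; lra.
rewrite !lebesgue_measure_itv/= !lte_fin ltrD2r.
by case: ifPn => // _; congr EFin; ring.
Qed.

Let shift_itv c a b : shift c @^-1` `[a + c, b + c]%classic = `[a, b]%classic.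
Proof. by apply/seteqP; split => z /=; rewrite !in_itv/= /shift; lra. Qed.

Lemma locint_shift c u : locint u -> locint (fun x => u (x + c)).
Proof.
move=> lu a b; apply/integrableP; split.
  apply/measurable_EFinP; apply: measurable_funTS.
  by apply: measurableT_comp (measurable_locint lu) (measurable_shift c).
have /integrableP[mu_] := lu (a + c) (b + c).
rewrite (@eq_measure_integral _ _ _ _ (pushforward mu (shift c))); last first.
  by move=> A mA _; exact: lebesgue_measure_shift.
rewrite ge0_integral_pushforward ?shift_itv//.
by apply: measurableT_comp.
Qed.

(** Lebesgue measure is its own image under a translation, as it is determined
    by its values on intervals. *)
Lemma Int_shift c a b u : locint u ->
  Int (a + c) (b + c) u = Int a b (fun x => u (x + c)).
Proof.
move=> lu; congr fine.
rewrite (@eq_measure_integral _ _ _ _ (pushforward mu (shift c))); last first.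
  by move=> A mA _; exact: lebesgue_measure_shift.
rewrite integral_pushforward ?shift_itv//.
  by apply/measurable_EFinP; exact: measurable_locint.
exact: (locint_shift c lu).
Qed.

End Translation.

Section WholeLine.
Context {R : realType}.
Implicit Types (a b C : R) (u : R -> R).
Local Notation mu := (@lebesgue_measure R).

Lemma EFin_Int a b u : locint u ->
  (Int a b u)%:E = (\int[mu]_(x in `[a, b]) (u x)%:E)%E.
Proof. by move=> lu; rewrite fineK//; apply: integrable_fin_num. Qed.

Lemma Int_le_integral u a b : locint u -> (forall x, 0 <= u x) ->
  ((Int a b u)%:E <= \int[mu]_x (u x)%:E)%E.
Proof.
move=> lu u0; rewrite EFin_Int//; apply: ge0_subset_integral => //.
- by apply/measurable_EFinP; exact: measurable_locint.
- by move=> x _; rewrite lee_fin.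
Qed.

(** Monotone convergence along the intervals [a - n, b + n].  The centre is free
    because integer steps from arbitrary end points are the only ones along
    which the energy is known to grow. *)
Lemma integral_le_Int u a b C : locint u -> (forall x, 0 <= u x) ->
  (exists N, forall n : nat, (N <= n)%N -> Int (a - n%:R) (b + n%:R) u <= C) ->
  (\int[mu]_x (u x)%:E <= C%:E)%E.
Proof.
move=> lu u0 [N uC].
pose F (n : nat) : set (measurableTypeR R) := `[a - n%:R, b + n%:R]%classic.
have UF : \bigcup_n F n = [set: R].
  apply/seteqP; split => // x _.
  exists (Num.truncn (`|x| + `|a| + `|b|)).+1 => //; rewrite /F/= in_itv/=.
  have := truncnS_gt (`|x| + `|a| + `|b|).
  have := ler_norm x; have := ler_norm (- x).
  have := ler_norm a; have := ler_norm (- b).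
  have := normr_ge0 a; have := normr_ge0 b.
  rewrite !normrN; lra.
have := @ge0_nondecreasing_set_cvg_integral _ _ R F (EFin \o u)
  (@lebesgue_measure R).
rewrite UF => /(_ _ _ _ _)/cvg_lim <-//; last 4 first.
- apply/nondecreasing_seqP => n; rewrite subsetEset => x; rewrite /F/= !in_itv/=.
  by rewrite -natr1; lra.
- by move=> n; exact: measurable_itv.
- by move=> n; apply/measurable_EFinP/measurable_funTS; exact: measurable_locint.
- by move=> n x _; rewrite lee_fin.
apply: lime_le.
  apply: ereal_nondecreasing_is_cvgn.
  apply: ge0_nondecreasing_set_nondecreasing_integral.
  - apply/nondecreasing_seqP => n; rewrite subsetEset => x; rewrite /F/= !in_itv/=.
    by rewrite -natr1; lra.
  - by move=> n; exact: measurable_itv.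
  - by move=> n; apply/measurable_EFinP/measurable_funTS; exact: measurable_locint.
  - by move=> n x _; rewrite lee_fin.
by near=> n; rewrite -EFin_Int// lee_fin uC//; near: n; exact: nbhs_infty_ge.
Unshelve. all: by end_near. Qed.

End WholeLine.

(** * The du Bois-Reymond lemma *)

Section Increments.
Context {R : realType}.
Implicit Types (a b c s t x : R) (u v w h : R -> R).
Local Notation mu := (@lebesgue_measure R).

Lemma Int_oo a b u : locint u -> \int[mu]_(x in `]a, b[) u x = Int a b u.
Proof.
move=> lu; rewrite Rintegral_itv_obnd_cbnd ?Rintegral_itv_bndo_bndc//.
  by apply: integrableS (lu a b) => //; exact: subset_itv_co_cc.
by apply: integrableS (lu a b) => //; exact: subset_itv_oo_cc.
Qed.

Lemma continuous_bounded_itv u a b : continuous u ->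
  exists2 M, 0 < M & forall x, a <= x <= b -> `|u x| <= M.
Proof.
move=> cu.
have /compact_bounded[M [_ uM]] :
    compact (u @` `[a, b]).
  by apply: continuous_compact;
    [exact: continuous_subspaceT|exact: segment_compact].
exists (`|M| + 1); first by rewrite ltr_wpDl.
by move=> x xab; apply: (uM (`|M| + 1)); [rewrite ltr_pwDr// ler_norm|exists x].
Qed.

Lemma Int_supp s t a b u : locint u -> a <= s -> s <= t -> t <= b ->
  (forall x, x <= s -> u x = 0) -> (forall x, t <= x -> u x = 0) ->
  Int a b u = Int s t u.
Proof.
move=> lu as_ st tb us ut.
rewrite (Int_split lu as_ (le_trans st tb)) (Int_split lu st tb).
rewrite (@eq_Int R a s u (fun=> 0)); last by move=> x /andP[_ /us].
rewrite (@eq_Int R t b u (fun=> 0)); last by move=> x /andP[/ut].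
by rewrite !Int_cst// !mul0r add0r addr0.
Qed.

(** Continuous functions supported in [s, t] that converge to the indicator
    of ]s, t[ as n grows. *)
Definition trap s t (n : nat) x : R :=
  Num.min 1 (n%:R * Num.max 0 (Num.min (x - s) (t - x))).

Lemma trap_ge0 s t n x : 0 <= trap s t n x.
Proof. by rewrite le_min ler01 mulr_ge0// le_max lexx. Qed.

Lemma trap_le1 s t n x : trap s t n x <= 1.
Proof. by rewrite ge_min lexx. Qed.

Lemma trap_left s t n x : x <= s -> trap s t n x = 0.
Proof.
move=> xs; have H : Num.min (x - s) (t - x) <= 0 by rewrite ge_min subr_le0 xs.
by rewrite /trap (max_l H) mulr0 min_r.
Qed.

Lemma trap_right s t n x : t <= x -> trap s t n x = 0.
Proof.
move=> tx.
have H : Num.min (x - s) (t - x) <= 0 by rewrite ge_min orbC subr_le0 tx.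
by rewrite /trap (max_l H) mulr0 min_r.
Qed.

Lemma continuous_trap s t n : continuous (trap s t n).
Proof.
have cid : continuous (fun x : R => x) by move=> x; exact: cvg_id.
have ccst (z : R) : continuous (fun _ : R => z) by move=> x; exact: cvg_cst.
have cmin (u v : R -> R) : continuous u -> continuous v ->
    continuous (fun x => Num.min (u x) (v x)).
  by move=> cu cv x; exact: (@continuous_min _ _ u v x (cu x) (cv x)).
have cmax (u v : R -> R) : continuous u -> continuous v ->
    continuous (fun x => Num.max (u x) (v x)).
  by move=> cu cv x; exact: (@continuous_max _ _ u v x (cu x) (cv x)).
have c1 : continuous (fun x => x - s).
  by move=> x; apply: cvgB; [exact: cid|exact: ccst].
have c2 : continuous (fun x => t - x).
  by move=> x; apply: cvgB; [exact: ccst|exact: cid].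
have c3 := cmax _ _ (ccst 0) (cmin _ _ c1 c2).
by apply: (cmin _ _ (ccst 1)) => x; apply: cvgM; [exact: ccst|exact: c3].
Qed.

Lemma trap_cvg s t (x : R) : s < x < t -> trap s t n x @[n --> \oo] --> (1 : R).
Proof.
move=> /andP[sx xt]; apply: cvg_near_cst.
have d0 : 0 < Num.min (x - s) (t - x) by rewrite lt_min !subr_gt0 sx.
near=> n; rewrite /trap max_r ?ltW// min_l// -ler_pdivrMr// mul1r.
by near: n; exact: nbhs_infty_ger.
Unshelve. all: by end_near. Qed.

Lemma cvg_Int_trap s t w : locint w ->
  Int s t (fun x => w x * trap s t n x) @[n --> \oo] --> Int s t w.
Proof.
move=> lw.
have lwt n : locint (fun x => w x * trap s t n x).
  apply: le_locint (locint_norm lw) _.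
    apply: measurable_funM; first exact: measurable_locint.
    by apply: continuous_measurable_fun; exact: continuous_trap.
  move=> x; rewrite normrM (ger0_norm (trap_ge0 _ _ _ _)).
  by rewrite ler_piMr// trap_le1.
have lo u : locint u -> mu.-integrable `]s, t[ (EFin \o u).
  by move=> lu; apply: integrableS (lu s t) => //; exact: subset_itv_oo_cc.
have Eo u : locint u -> (\int[mu]_(x in `]s, t[) (u x)%:E = (Int s t u)%:E)%E.
  move=> lu; rewrite -Int_oo// fineK//; apply: integrable_fin_num => //.
  exact: lo.
have [] := @dominated_convergence _ _ R mu `]s, t[ _
  (fun n x => (w x * trap s t n x)%:E) (EFin \o w) (fun x => `|w x|%:E).
- exact: measurable_itv.
- by move=> n; exact: measurable_int (lo _ (lwt n)).
- exact: measurable_int (lo _ lw).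
- apply: aeW => x; rewrite /= in_itv/= => xst; apply: cvg_EFin.
    exact: nearW.
  rewrite -[X in _ --> X]mulr1; apply: cvgM; first exact: cvg_cst.
  exact: trap_cvg.
- exact: lo (locint_norm lw).
- apply: aeW => x n _; rewrite lee_fin normrM (ger0_norm (trap_ge0 _ _ _ _)).
  by rewrite ler_piMr// trap_le1.
move=> _ _; rewrite Eo//.
under eq_fun do rewrite Eo//.
by move=> /fine_cvgP[].
Qed.

(** Testing with the combination of approximate indicators of [s, t] and [0, 1]
    that has integral zero shows that w has the same mean value on both
    intervals.  Comparing mean values avoids any density argument. *)
Lemma du_Bois_Reymond w : locint w ->
  (forall (psi : R -> R) M, 0 < M -> continuous psi ->
     (forall x, M <= `|x| -> psi x = 0) -> Int (- M) M psi = 0 ->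
     Int (- M) M (fun x => w x * psi x) = 0) ->
  exists c, forall s t, s <= t -> Int s t w = c * (t - s).
Proof.
move=> lw w0; exists (Int 0 1 w) => s t st.
pose Z a b n := Int a b (trap a b n).
pose Y a b n := Int a b (fun x => w x * trap a b n x).
have lt a b n : locint (trap a b n) by apply: locint_cont; exact: continuous_trap.
have lwt a b n : locint (fun x => w x * trap a b n x).
  apply: le_locint (locint_norm lw) _.
    apply: measurable_funM; first exact: measurable_locint.
    by apply: continuous_measurable_fun; exact: continuous_trap.
  move=> x; rewrite normrM (ger0_norm (trap_ge0 _ _ _ _)).
  by rewrite ler_piMr// trap_le1.
have cZ a b : a <= b -> Z a b n @[n --> \oo] --> b - a.
  move=> ab; have := @cvg_Int_trap a b _ (locint_cst 1).
  rewrite Int_cst// mul1r; apply: cvg_trans; apply: near_eq_cvg.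
  by apply: nearW => n; apply: eq_Int => x _; rewrite mul1r.
have E n : Z 0 1 n * Y s t n = Z s t n * Y 0 1 n.
  pose M := `|s| + `|t| + 2.
  have Ms : - M <= s by have := ler_norm (- s); have := normr_ge0 t; rewrite normrN /M; lra.
  have Mt : t <= M by have := ler_norm t; have := normr_ge0 s; rewrite /M; lra.
  have M0 : 0 < M by have := normr_ge0 t; have := normr_ge0 s; rewrite /M; lra.
  have M1 : 2 <= M by have := normr_ge0 t; have := normr_ge0 s; rewrite /M; lra.
  have ZE : Int (- M) M (trap s t n) = Z s t n.
    by apply: Int_supp => // x; [exact: trap_left|exact: trap_right].
  have ZE' : Int (- M) M (trap 0 1 n) = Z 0 1 n.
    by apply: Int_supp => //; try lra; move=> x;
      (exact: trap_left || exact: trap_right).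
  have YE : Int (- M) M (fun x => w x * trap s t n x) = Y s t n.
    by apply: Int_supp => // x xs; ((by rewrite trap_left ?mulr0) || (by rewrite trap_right ?mulr0)).
  have YE' : Int (- M) M (fun x => w x * trap 0 1 n x) = Y 0 1 n.
    by apply: Int_supp => //; try lra; move=> x xs;
      ((by rewrite trap_left ?mulr0) || (by rewrite trap_right ?mulr0)).
  have := w0 (fun x => Z 0 1 n * trap s t n x - Z s t n * trap 0 1 n x) M M0.
  have l1 z a b : locint (fun x => z * trap a b n x) by exact: locintZ.
  have l2 z a b : locint (fun x => z * (w x * trap a b n x)) by exact: locintZ.
  rewrite IntB// !IntZ// ZE ZE' mulrC subrr.
  have -> : (fun x => w x * (Z 0 1 n * trap s t n x - Z s t n * trap 0 1 n x)) =
     (fun x => Z 0 1 n * (w x * trap s t n x) - Z s t n * (w x * trap 0 1 n x)).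
    by apply/funext => x; ring.
  rewrite IntB// !IntZ// YE YE' => /(_ _ _ erefl) H.
  apply/eqP; rewrite -subr_eq0; apply/eqP/H.
    by move=> x; apply: cvgB; apply: cvgM;
      (exact: cvg_cst || exact: continuous_trap).
  move=> x; rewrite ler_normr => /orP[] Mx.
    by rewrite !trap_right ?mulr0 ?subrr//; clear -Mx M1 Mt; lra.
  by rewrite !trap_left ?mulr0 ?subrr//; clear -Mx M1 Ms; lra.
have c1 : Z 0 1 n * Y s t n @[n --> \oo] --> (1 - 0) * Int s t w.
  by apply: cvgM; [exact: cZ|exact: cvg_Int_trap].
have c2 : Z s t n * Y 0 1 n @[n --> \oo] --> (t - s) * Int 0 1 w.
  by apply: cvgM; [exact: cZ|exact: cvg_Int_trap].
move: c1; rewrite (_ : (fun n => _) = (fun n => Z s t n * Y 0 1 n)).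
  by move=> c1; rewrite mulrC -(cvg_unique _ c1 c2)// subr0 mul1r.
exact/funext.
Qed.

End Increments.

(** * Weak derivatives and absolutely continuous representatives *)

Section WeakDerivative.
Context {R : realType}.
Implicit Types (a b c s t x : R) (u v w h phi : R -> R).
Local Notation mu := (@lebesgue_measure R).

Lemma L1_approx v a b e : locint v -> 0 < e ->
  exists2 w, continuous w & Int a b (fun x => `|v x - w x|) < e.
Proof.
move=> lv e0.
have [||w [cw _ /fine_cvgP[_ /cvgrPdist_lt/(_ e e0)[N _ HN]]]] :=
  @approximation_continuous_integrable R `[a, b]%classic v _ _ (lv a b).
- exact: measurable_itv.
- by rewrite /= lebesgue_measure_itv/=; case: ifPn => // _; exact: ltry.
exists (w N) => //; have := HN N (leqnn N).
by rewrite sub0r normrN /= => /(le_lt_trans (ler_norm _)).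
Qed.

Lemma sqr_Int_le h a b x y : L2loc h -> a <= x -> x <= y -> y <= b ->
  Int x y h ^+ 2 <= (y - x) * Int a b (fun z => h z ^+ 2).
Proof.
move=> lh ax xy yb; apply: le_trans (Cauchy_Schwarz xy lh) _.
rewrite ler_wpM2l ?subr_ge0// le_Int_itv//; first by case: lh.
by move=> z; rewrite sqr_ge0.
Qed.

Lemma sqr_dist_Int h u a b x y : L2loc h ->
  (forall s t, s <= t -> u t - u s = Int s t h) ->
  a <= x <= b -> a <= y <= b ->
  (u y - u x) ^+ 2 <= `|y - x| * Int a b (fun z => h z ^+ 2).
Proof.
move=> lh uh /andP[ax xb] /andP[ay yb]; have [xy|/ltW yx] := leP x y.
  by rewrite uh// ger0_norm ?subr_ge0// sqr_Int_le.
by rewrite -sqrrN opprB uh// ler0_norm ?subr_le0// opprB sqr_Int_le.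
Qed.

(** By Cauchy-Schwarz u is even locally Hoelder continuous of exponent 1/2. *)
Lemma cont_increment h u : L2loc h ->
  (forall s t, s <= t -> u t - u s = Int s t h) -> continuous u.
Proof.
move=> lh uh x; apply/cvgrPdist_lt => e e0.
set Q := Int (x - 1) (x + 1) (fun z => h z ^+ 2).
have Q0 : 0 <= Q by apply: Int_ge0 => z _; rewrite sqr_ge0.
have d0 : 0 < Num.min 1 (e ^+ 2 / (Q + 1)).
  by rewrite lt_min ltr01 divr_gt0 ?exprn_gt0// ltr_wpDl.
near=> y.
have : `|x - y| < Num.min 1 (e ^+ 2 / (Q + 1)).
  by near: y; exact: (@cvgr_dist_lt _ _ _ _ _ id x cvg_id _ d0).
rewrite lt_min => /andP[xy1]; rewrite ltr_pdivlMr ?ltr_wpDl// => xye.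
have := @sqr_dist_Int h u (x - 1) (x + 1) y x lh uh.
move: xy1; rewrite ltr_norml -/Q => /andP[? ?] H.
have {}H : (u x - u y) ^+ 2 <= `|x - y| * Q by apply: H; lra.
rewrite -ltr_sqr ?nnegrE ?(ltW e0)// real_normK ?num_real//.
by apply: le_lt_trans H _; have := normr_ge0 (x - y); nra.
Unshelve. all: by end_near. Qed.

Lemma is_deriveMR u v (x du dv : R) : is_derive x 1 u du -> is_derive x 1 v dv ->
  is_derive x 1 (fun y => u y * v y) (u x * dv + du * v x).
Proof.
move=> hu hv; have H := @is_deriveM _ _ u v x 1 du dv hu hv.
apply: (is_derive_eq H); rewrite mulrC addrC [in RHS]addrC.
by congr (_ + _); rewrite mulrC.
Qed.

(** For continuous v this is the product rule.  In general v is approximated in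
    L^1(a, b) by continuous functions w; the primitives converge uniformly, so
    that both sides pass to the limit. *)
Lemma Int_by_parts u v phi psi a b : a <= b -> L2loc v ->
  (forall s t, s <= t -> u t - u s = Int s t v) ->
  continuous psi -> (forall x : R, is_derive x 1 phi (psi x)) ->
  phi a = 0 -> phi b = 0 ->
  Int a b (fun x => u x * psi x) = - Int a b (fun x => v x * phi x).
Proof.
move=> ab l2v uv cpsi dphi pa pb.
have lv := L2loc_locint l2v.
have cphi := is_derive_cont dphi.
have cu := cont_increment l2v uv.
have l2phi := L2loc_cont cphi.
have lvphi : locint (fun x => v x * phi x) by exact: L2locM.
have lupsi : locint (fun x => u x * psi x).
  by apply: locint_cont => x; apply: cvgM; [exact: cu|exact: cpsi].
have [M1 M10 M1psi] := @continuous_bounded_itv _ psi a b cpsi.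
have [M2 M20 M2phi] := @continuous_bounded_itv _ phi a b cphi.
apply/eqP; rewrite -subr_eq0 opprK; apply/eqP.
set S := Int _ _ _ + _.
have K0 : 0 < M1 * (b - a) + M2 by rewrite ltr_wpDl// mulr_ge0// ?subr_ge0// ltW.
suff SE : forall e, 0 < e -> `|S| <= e * (M1 * (b - a) + M2).
  apply/eqP; rewrite -normr_eq0 eq_le normr_ge0 andbT leNgt; apply/negP => S0.
  set K := (M1 * _ + _) in K0 SE.
  have : `|S| <= `|S| / (2 * K) * K by apply: SE; rewrite divr_gt0 ?mulr_gt0.
  have -> : `|S| / (2 * K) * K = `|S| / 2 by field; rewrite gt_eqF.
  lra.
move=> e e0; have [w cw we] := L1_approx a b lv e0.
have lw := locint_cont cw.
have lvw : locint (fun x => `|v x - w x|) by apply/locint_norm/locintB.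
pose U x := prim w x + (u a - prim w a).
have dU x : is_derive x 1 U (w x).
  have H := is_derive_prim x cw.
  by rewrite /U; apply: is_derive_eq; rewrite addr0.
have cU := is_derive_cont dU.
have lwphi : locint (fun x => w x * phi x).
  by apply: locint_cont => x; apply: cvgM; [exact: cw|exact: cphi].
have lUpsi : locint (fun x => U x * psi x).
  by apply: locint_cont => x; apply: cvgM; [exact: cU|exact: cpsi].
have parts : Int a b (fun x => U x * psi x) + Int a b (fun x => w x * phi x) = 0.
  have cUp : continuous (fun x => U x * psi x + w x * phi x).
    by move=> x; apply: cvgD; apply: cvgM; [exact: cU|exact: cpsi|exact: cw|exact: cphi].
  have dUp x : is_derive x 1 (fun y => U y * phi y) (U x * psi x + w x * phi x).
    exact: is_deriveMR.
  by rewrite -IntD// (FTC ab cUp dUp) pa pb !mulr0 subrr.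
have -> : S = Int a b (fun x => (u x - U x) * psi x) +
              Int a b (fun x => (v x - w x) * phi x).
  under [X in _ = X + _]eq_Int do rewrite mulrBl.
  under [X in _ = _ + X]eq_Int do rewrite mulrBl.
  by rewrite !IntB// /S; lra.
have lD : locint (fun x => (v x - w x) * phi x).
  under [X in locint X]funext do rewrite mulrBl.
  exact: locintB.
have lD' : locint (fun x => (u x - U x) * psi x).
  under [X in locint X]funext do rewrite mulrBl.
  exact: locintB.
apply: le_trans (ler_normD _ _) _; rewrite mulrDr; apply: lerD.
  apply: le_trans (le_norm_Int _ _ lD') _.
  rewrite (_ : e * _ = (e * M1) * (b - a)); last by ring.
  apply: Int_le_cst => //; first exact: locint_norm.
  move=> x /andP[ax xb]; rewrite normrM ler_pM//; last by apply: M1psi; rewrite ax.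
  have -> : u x - U x = Int a x (fun x => v x - w x).
    by rewrite IntB// -uv// -primB// /U; ring.
  apply: le_trans (le_norm_Int _ _ _) _; first exact: locintB.
  by apply: le_trans (ltW we); apply: le_Int_itv.
apply: le_trans (le_norm_Int _ _ lD) _.
apply: (@le_trans _ _ (Int a b (fun x => M2 * `|v x - w x|))).
  apply: le_Int; [exact: locint_norm|exact: locintZ|move=> x xab].
  by rewrite normrM mulrC ler_wpM2r// M2phi.
by rewrite IntZ// mulrC ler_wpM2r// ltW.
Qed.

(** H^2_loc(R) with continuously differentiable representatives: g is the
    derivative of f, and h the one of the absolutely continuous g. *)
Definition H2 f g h := [/\ forall x : R, is_derive x 1 f (g x), continuous g,
  L2loc h & forall s t, s <= t -> g t - g s = Int s t h].

Lemma weak_derivative_increment u v a b : a < b -> L2loc v ->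
  (forall s t, s <= t -> u t - u s = Int s t v) -> weak_derivative a b u v.
Proof.
move=> ab l2v uv phi [dphi cphi [K [_ Kab phi0]]].
have d x : is_derive x 1 phi (derive1 phi x).
  by apply: DeriveDef; rewrite ?derive1E.
have cu := cont_increment l2v uv.
rewrite !Int_oo; last 2 first.
- by apply: L2locM => //; apply: L2loc_cont; exact: is_derive_cont d.
- by apply: locint_cont => x; apply: cvgM; [exact: cu|exact: cphi].
apply: Int_by_parts => //; first exact: ltW.
- by apply: phi0 => /Kab; rewrite /= in_itv/= ltxx.
- by apply: phi0 => /Kab; rewrite /= in_itv/= ltxx andbF.
Qed.

Lemma L2_on_L2loc a b h : L2loc h -> L2_on a b h.
Proof.
move=> [mh lh]; split; first exact: measurable_funTS.
by apply: integrableS (lh a b) => //; exact: subset_itv_oo_cc.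
Qed.

Lemma H2_W22loc f g h : H2 f g h -> W22loc f (g, h).
Proof.
move=> [df cg l2h gh]; have cf := is_derive_cont df; split=> // a b ab.
split=> /=; try (apply: L2_on_L2loc => //; exact: L2loc_cont).
- apply: weak_derivative_increment => //; first exact: L2loc_cont.
  by move=> s t st; rewrite (@FTC _ s t f).
- exact: weak_derivative_increment.
Qed.

Lemma L2loc_L2_on h : (forall a b, a < b -> L2_on a b h) -> L2loc h.
Proof.
move=> lh; split.
  have -> : [set: R] = \bigcup_n `](- n.+1%:R), n.+1%:R[%classic.
    apply/esym/seteqP; split => // x _.
    exists (Num.truncn `|x|) => //=; rewrite in_itv/= -ltr_norml.
    exact: truncnS_gt.
  apply/measurable_fun_bigcup => // n.
  by have [] := lh (- n.+1%:R) n.+1%:R; rewrite // gtrN.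
move=> a b; have [ab|ba] := leP a b; last first.
  by rewrite set_itv_ge ?bnd_simp -?ltNge//; exact: integrable_set0.
have [] := lh (a - 1) (b + 1); first by lra.
move=> _; apply: integrableS => //.
by move=> x /=; rewrite !in_itv/=; lra.
Qed.

(** u and the primitive of its weak derivative have the same weak derivative, so
    their difference is orthogonal to all derivatives of test functions, that
    is to all continuous compactly supported functions of mean zero. *)
Lemma weak_derivative_primitive u v : locint u -> L2loc v ->
  (forall a b, a < b -> weak_derivative a b u v) ->
  exists c, forall s t, s <= t -> Int s t (fun x => u x - prim v x) = c * (t - s).
Proof.
move=> lu l2v uv; have lv := L2loc_locint l2v.
have V s t : s <= t -> prim v t - prim v s = Int s t v by exact: primB.
have cV := cont_increment l2v V.
apply: du_Bois_Reymond; first by apply: locintB => //; exact: locint_cont.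
move=> psi M M0 cpsi psi0 psiI.
have lpsi := locint_cont cpsi.
pose phi x := prim psi x - prim psi (- M).
have dphi x : is_derive x 1 phi (psi x).
  have H := is_derive_prim x cpsi.
  by rewrite /phi; apply: is_derive_eq; rewrite subr0.
have E : derive1 phi = psi.
  by apply/funext => x; rewrite derive1E; have [] := dphi x.
have phiL x : x <= - M -> phi x = 0.
  move=> xM; rewrite /phi -opprB primB// (@eq_Int _ _ _ _ (fun=> 0)).
    by rewrite Int_cst// mul0r oppr0.
  by move=> y /andP[_ yM]; rewrite psi0// ler_normr orbC lerNr yM.
have phiR x : M <= x -> phi x = 0.
  move=> Mx; rewrite /phi primB//; last by lra.
  rewrite (@Int_split _ M)//; last by lra.
  rewrite psiI add0r (@eq_Int _ _ _ _ (fun=> 0)).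
    by rewrite Int_cst// mul0r.
  by move=> y /andP[My _]; rewrite psi0// ler_normr My.
have C : C1c (- M - 1) (M + 1) phi.
  split; first by move=> x; have [] := dphi x.
    by rewrite E.
  exists `[- M, M]%classic; split; first exact: segment_compact.
    by move=> x; rewrite /= !in_itv/=; lra.
  move=> x; rewrite /= in_itv/= => /negP; rewrite negb_and -!ltNge.
  by move=> /orP[/ltW/phiL|/ltW/phiR].
have MM : - M - 1 < M + 1 by lra.
have lupsi : locint (fun x => u x * psi x).
  have [B B0 uB] := @continuous_bounded_itv _ psi (- M) M cpsi.
  apply: (@le_locint _ _ (fun x => B * `|u x|)).
  - apply: measurable_funM; first exact: measurable_locint.
    exact: measurable_locint.
  - by apply: locintZ; exact: locint_norm.
  - move=> x; rewrite normrM mulrC ler_wpM2r//.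
    have [xM|/ltW Mx] := leP `|x| M; first by apply: uB; rewrite -ler_norml.
    by rewrite psi0// normr0 ltW.
have lVpsi : locint (fun x => prim v x * psi x).
  by apply: locint_cont => x; apply: cvgM; [exact: cV|exact: cpsi].
have lvphi : locint (fun x => v x * phi x).
  by apply: L2locM => //; apply: L2loc_cont; exact: is_derive_cont dphi.
have W1 := uv _ _ MM _ C; have W2 := weak_derivative_increment MM l2v V C.
rewrite -{}W2 E !Int_oo// in W1.
under eq_Int do rewrite mulrBl.
rewrite IntB//; apply/eqP; rewrite subr_eq0; apply/eqP.
by rewrite -(@Int_supp _ (- M) M (- M - 1) (M + 1))//
     -1?(@Int_supp _ (- M) M (- M - 1) (M + 1))//; try (clear -M0; lra);
  move=> x xM; rewrite psi0 ?mulr0// ler_normr ?xM// lerNr xM orbT.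
Qed.

Lemma Int_eq0_cont w : continuous w ->
  (forall s t, s <= t -> Int s t w = 0) -> forall x, w x = 0.
Proof.
move=> cw w0 x; have lw := locint_cont cw.
have [_ <-] := is_derive_prim x cw.
have -> : prim w = cst 0.
  by apply/funext => y; rewrite /prim; case: leP => y0; rewrite w0 ?oppr0// ltW.
exact: derive_cst.
Qed.

(** Lebesgue differentiation of the primitive, which is constant. *)
Lemma Int_eq0_ae w : locint w ->
  (forall s t, s <= t -> Int s t w = 0) -> {ae mu, forall x, w x = 0}.
Proof.
move=> lw w0.
have locw : locally_integrable [set: R] w.
  split; [exact: measurable_locint|exact: openT|move=> K _ cK].
  have /compact_bounded[M [_ KM]] := cK.
  have KS : K `<=` `[- (`|M| + 1), `|M| + 1].
    move=> x Kx; rewrite /= in_itv/= -ler_norml.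
    by apply: (KM (`|M| + 1)) => //; rewrite ltr_pwDr// ler_norm.
  have : mu.-integrable K (EFin \o w).
    apply: integrableS (lw (- (`|M| + 1)) (`|M| + 1)); last exact: KS.
      exact: measurable_itv.
    exact: compact_measurable.
  by move=> /integrableP[].
have H (n : nat) : {ae mu, forall x, - n%:R < x -> w x = 0}.
  have := @FTC1 R w (BLeft (- n%:R)) (fun y => lw (- n%:R) y) locw.
  apply: (@filterS _ _ (ae_filter_ringOfSetsType mu)) => x /= H nx; have [] := H nx; move=> dF <-.
  rewrite derive1E (@near_eq_derive _ _ _ _ (cst 0)) ?oner_eq0 ?derive_cst//.
  near=> y; apply: w0; near: y; exact: lt_le_nbhsr.
have /ae_foralln := H.
apply: (@filterS _ _ (ae_filter_ringOfSetsType mu)) => x Hx; apply: (Hx (Num.truncn (- x)).+1).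
by rewrite ltrNl truncnS_gt.
Unshelve. all: by end_near. Qed.

(** g is the primitive of f2 that coincides with f1 almost everywhere.  Then f is
    a primitive of f1, hence of the continuous g, and so differentiable. *)
Lemma W22loc_H2 f f1 f2 : W22loc f (f1, f2) ->
  exists g, H2 f g f2 /\ {ae mu, forall x, f1 x = g x}.
Proof.
move=> [cf Hf].
have l2f1 : L2loc f1 by apply: L2loc_L2_on => a b ab; case: (Hf a b ab).
have l2f2 : L2loc f2 by apply: L2loc_L2_on => a b ab; case: (Hf a b ab).
have lf1 := L2loc_locint l2f1; have lf2 := L2loc_locint l2f2.
have V1 s t : s <= t -> prim f1 t - prim f1 s = Int s t f1 by exact: primB.
have V2 s t : s <= t -> prim f2 t - prim f2 s = Int s t f2 by exact: primB.
have cV1 := cont_increment l2f1 V1.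
have cV2 := cont_increment l2f2 V2.
have [||c1 Hc1] := @weak_derivative_primitive f f1 _ l2f1 _.
- exact: locint_cont.
- by move=> a b ab; case: (Hf a b ab).
have [||c2 Hc2] := @weak_derivative_primitive f1 f2 _ l2f2 _.
- by [].
- by move=> a b ab; case: (Hf a b ab).
pose g x := prim f2 x + c2.
have cg : continuous g by move=> x; apply: cvgD; [exact: cV2|exact: cvg_cst].
have lg := locint_cont cg.
have I0 s t : s <= t -> Int s t (fun x => f1 x - g x) = 0.
  move=> st; rewrite (@eq_Int _ _ _ _ (fun x => f1 x - prim f2 x - c2)).
    rewrite IntB ?Hc2 ?Int_cst ?subrr//; last exact: locint_cst.
    by apply: locintB => //; exact: locint_cont.
  by move=> x _; rewrite /g; ring.
have f0 x : f x = prim g x + c1.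
  have H : forall x, f x - prim f1 x - c1 = 0.
    apply: Int_eq0_cont.
      move=> y; apply: cvgB; last exact: cvg_cst.
      by apply: cvgB; [exact: cf|exact: cV1].
    move=> s t st.
    rewrite IntB ?Hc1 ?Int_cst ?subrr//; last exact: locint_cst.
    by apply: locintB; apply: locint_cont.
  have -> : prim g x = prim f1 x; last by have := H x; lra.
  have IE s t : s <= t -> Int s t g = Int s t f1.
    by move=> st; have := I0 _ _ st; rewrite IntB//; lra.
  by rewrite /prim; case: leP => x0; rewrite IE// ltW.
exists g; split; last first.
  have := Int_eq0_ae (locintB lf1 lg) I0.
  by apply: (@filterS _ _ (ae_filter_ringOfSetsType mu)) => x /eqP; rewrite subr_eq0 => /eqP.
split=> //.
- move=> x; have -> : f = (fun x => prim g x + c1) by exact/funext.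
  have H := is_derive_prim x cg.
  by apply: is_derive_eq; rewrite addr0.
- by move=> s t st; rewrite -V2// /g; ring.
Qed.

End WeakDerivative.

(** * Gluing and cubic Hermite interpolation *)

Section H2Operations.
Context {R : realType}.
Implicit Types (a b c s t x z : R) (f g h u v : R -> R).

Lemma H2_cont f g h : H2 f g h -> continuous f.
Proof. by case=> df _ _ _; exact: is_derive_cont df. Qed.

Lemma H2_cont1 f g h : H2 f g h -> continuous g.
Proof. by case. Qed.

Lemma H2_L2 f g h : H2 f g h -> L2loc h.
Proof. by case. Qed.

Lemma H2_incr f g h s t : H2 f g h -> s <= t -> f t - f s = Int s t g.
Proof. by move=> [df cg _ _] st; rewrite (FTC st cg df). Qed.

Lemma H2_incr1 f g h s t : H2 f g h -> s <= t -> g t - g s = Int s t h.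
Proof. by move=> [_ _ _]; apply. Qed.

Lemma H2_of_increments f g h : L2loc h ->
  (forall s t, s <= t -> f t - f s = Int s t g) ->
  (forall s t, s <= t -> g t - g s = Int s t h) -> H2 f g h.
Proof.
move=> lh fg gh; have cg := cont_increment lh gh; split => // x.
have -> : f = (fun y => prim g y + f 0).
  apply/funext => y; rewrite /prim; case: leP => y0.
    by rewrite -fg// subrK.
  by rewrite -fg ?ltW// opprB subrK.
have H := is_derive_prim x cg.
by apply: is_derive_eq; rewrite addr0.
Qed.

Lemma H2_of_C2 f g h : (forall x : R, is_derive x 1 f (g x)) ->
  (forall x : R, is_derive x 1 g (h x)) -> continuous h -> H2 f g h.
Proof.
move=> df dg ch; split=> //; first exact: is_derive_cont dg.
  exact: L2loc_cont.
by move=> s t st; rewrite (FTC st ch dg).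
Qed.

Lemma H2_cst c : H2 (fun=> c) (fun=> 0) (fun=> 0).
Proof.
by apply: H2_of_C2 => x; exact: cvg_cst.
Qed.

Lemma H2D f g h u v w : H2 f g h -> H2 u v w ->
  H2 (fun x => f x + u x) (fun x => g x + v x) (fun x => h x + w x).
Proof.
move=> F U; have lh := H2_L2 F; have lw := H2_L2 U.
have lg := locint_cont (H2_cont1 F); have lv := locint_cont (H2_cont1 U).
apply: H2_of_increments; first exact: L2locD.
- by move=> s t st; rewrite IntD// -(H2_incr F)// -(H2_incr U)//; ring.
- move=> s t st; rewrite IntD; [|exact: L2loc_locint..].
  by rewrite -(H2_incr1 F)// -(H2_incr1 U)//; ring.
Qed.

Lemma H2Z c f g h : H2 f g h ->
  H2 (fun x => c * f x) (fun x => c * g x) (fun x => c * h x).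
Proof.
move=> F; have lh := H2_L2 F; have lg := locint_cont (H2_cont1 F).
apply: H2_of_increments; first exact: L2locZ.
- by move=> s t st; rewrite IntZ// -(H2_incr F)// mulrBr.
- move=> s t st; rewrite IntZ; last exact: L2loc_locint.
  by rewrite -(H2_incr1 F)// mulrBr.
Qed.

Lemma L2loc_shift c h : L2loc h -> L2loc (fun x => h (x + c)).
Proof.
move=> [mh lh]; split; last exact: (locint_shift c lh).
exact: measurable_locint (locint_shift c (L2loc_locint (conj mh lh))).
Qed.

Lemma H2_shift c f g h : H2 f g h ->
  H2 (fun x => f (x + c)) (fun x => g (x + c)) (fun x => h (x + c)).
Proof.
move=> F; have lh := H2_L2 F; have lg := locint_cont (H2_cont1 F).
apply: H2_of_increments; first exact: L2loc_shift.
- by move=> s t st; rewrite -Int_shift// -(H2_incr F)// lerD2r.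
- move=> s t st; rewrite -Int_shift; last exact: L2loc_locint.
  by rewrite -(H2_incr1 F)// lerD2r.
Qed.

Lemma eq_Int_oo a b u v : locint u -> locint v ->
  (forall x, a < x < b -> u x = v x) -> Int a b u = Int a b v.
Proof.
move=> lu lv uv; rewrite -!Int_oo//; apply: eq_Rintegral => x.
by rewrite inE/= in_itv/= => /uv.
Qed.

Definition glue t u v x := if x <= t then u x else v x.

Lemma glue_le t u v x : x <= t -> glue t u v x = u x.
Proof. by rewrite /glue => ->. Qed.

Lemma glue_gt t u v x : t < x -> glue t u v x = v x.
Proof. by rewrite /glue ltNge => /negbTE ->. Qed.

Lemma glue_ge t u v x : u t = v t -> t <= x -> glue t u v x = v x.
Proof.
by move=> uv; rewrite le_eqVlt => /predU1P[<-|/glue_gt//]; rewrite glue_le.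
Qed.

Lemma measurable_glue t u v : measurable_fun setT u -> measurable_fun setT v ->
  measurable_fun setT (glue t u v).
Proof.
by move=> mu_ mv; apply: measurable_fun_ifT => //; exact: measurable_fun_ler.
Qed.

Lemma locint_glue t u v : locint u -> locint v -> locint (glue t u v).
Proof.
move=> lu lv; apply: le_locint (locintD (locint_norm lu) (locint_norm lv)) _.
  by apply: measurable_glue; exact: measurable_locint.
by move=> x; rewrite /glue; case: ifP => _; rewrite ?lerDl ?lerDr.
Qed.

Lemma L2loc_glue t u v : L2loc u -> L2loc v -> L2loc (glue t u v).
Proof.
move=> [mu_ lu] [mv lv]; split; first exact: measurable_glue.
have -> : (fun x => glue t u v x ^+ 2) =
    glue t (fun x => u x ^+ 2) (fun x => v x ^+ 2).
  by apply/funext => x; rewrite /glue; case: ifP.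
exact: locint_glue.
Qed.

Lemma Int_glue_le t a b u v : b <= t -> Int a b (glue t u v) = Int a b u.
Proof.
by move=> bt; apply: eq_Int => x /andP[_ xb]; rewrite glue_le// (le_trans xb).
Qed.

Lemma Int_glue_ge t a b u v : locint u -> locint v -> t <= a ->
  Int a b (glue t u v) = Int a b v.
Proof.
move=> lu lv ta; apply: eq_Int_oo => //; first exact: locint_glue.
by move=> x /andP[ax _]; rewrite glue_gt// (le_lt_trans ta).
Qed.

(** Gluing preserves the relation of being a primitive; this yields both the
    differentiability of a glued function and the absolute continuity of its
    derivative, without computing a derivative at the junction. *)
Lemma glue_increment t f f' g g' : locint g -> locint g' ->
  (forall a b, a <= b -> f b - f a = Int a b g) ->
  (forall a b, a <= b -> f' b - f' a = Int a b g') -> f t = f' t ->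
  forall a b, a <= b -> glue t f f' b - glue t f f' a = Int a b (glue t g g').
Proof.
move=> lg lg' fg fg' ft a b ab; have lG := locint_glue t lg lg'.
have [bt|tb] := leP b t.
  by rewrite !glue_le// ?(le_trans ab)// Int_glue_le// fg.
have [at_|ta] := leP a t; last first.
  by rewrite !glue_gt// Int_glue_ge// ?fg'// ltW.
rewrite (Int_split lG at_ (ltW tb)) Int_glue_le// Int_glue_ge// -fg// -fg' ?ltW//.
by rewrite (glue_gt _ _ tb) (glue_le _ _ at_) -ft; ring.
Qed.

Lemma H2_glue t f g h f' g' h' : H2 f g h -> H2 f' g' h' ->
  f t = f' t -> g t = g' t ->
  H2 (glue t f f') (glue t g g') (glue t h h').
Proof.
move=> F F' ft gt.
have lh := L2loc_locint (H2_L2 F); have lh' := L2loc_locint (H2_L2 F').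
have lg := locint_cont (H2_cont1 F); have lg' := locint_cont (H2_cont1 F').
apply: H2_of_increments.
- by apply: L2loc_glue; [exact: H2_L2 F|exact: H2_L2 F'].
- by apply: glue_increment => // a b ab; [exact: H2_incr F ab|exact: H2_incr F' ab].
- by apply: glue_increment => // a b ab; [exact: H2_incr1 F ab|exact: H2_incr1 F' ab].
Qed.

Lemma is_deriveDR u v x (du dv : R) : is_derive x 1 u du -> is_derive x 1 v dv ->
  is_derive x 1 (fun y => u y + v y) (du + dv).
Proof. by move=> hu hv; exact: is_deriveD. Qed.

(** The bound depends on T, which is harmless: it is used with T = 1 and with T
    fixed while eta tends to 0. *)
Lemma hermite z (T eta pl pr ql qr : R) : 1 <= T ->
  `|pl| <= eta -> `|pr| <= eta -> `|ql| <= eta -> `|qr| <= eta ->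
  exists w w1 w2 : R -> R, [/\ H2 w w1 w2, w (z - T) = pl /\ w (z + T) = pr,
    w1 (z - T) = ql /\ w1 (z + T) = qr &
    forall x, z - T <= x <= z + T ->
      [/\ `|w x| <= 20 * T * eta, `|w1 x| <= 20 * T * eta &
          `|w2 x| <= 20 * T * eta]].
Proof.
move=> T1 hpl hpr hql hqr; have T0 : T != 0 by lra.
pose P := (pr + pl) / 2; pose D := (pr - pl) / 2.
pose Q := (qr + ql) / 2 * T; pose S := (qr - ql) / 2 * T.
(* coefficients in the variable s = (x - z) / T, which ranges over [-1, 1] *)
pose a0 := P - S / 2; pose a1 := D - (Q - D) / 2.
pose a2 := S / 2; pose a3 := (Q - D) / 2.
pose s x := (x - z) / T.
pose w x := a0 + s x * (a1 + s x * (a2 + s x * a3)).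
pose w1 x := (a1 + s x * (2 * a2 + s x * (3 * a3))) / T.
pose w2 x := (2 * a2 + s x * (6 * a3)) / T / T.
have ds x : is_derive x 1 s T^-1.
  have H : is_derive x 1 (fun y : R => y + - z) (1 + 0).
    exact: is_deriveDR.
  have := is_deriveMR H (is_derive_cst T^-1 x 1).
  by rewrite mulr0 add0r addr0 mul1r.
have da (a x : R) : is_derive x 1 (fun=> a) 0 by exact: is_derive_cst.
exists w, w1, w2; split.
- apply: H2_of_C2.
  + move=> x.
    have H := is_deriveDR (da a0 x) (is_deriveMR (ds x) (is_deriveDR (da a1 x)
      (is_deriveMR (ds x) (is_deriveDR (da a2 x) (is_deriveMR (ds x) (da a3 x)))))).
    by apply: (is_derive_eq H); rewrite /w1; field.
  + move=> x.
    have H := is_deriveMR (is_deriveDR (da a1 x)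
      (is_deriveMR (ds x) (is_deriveDR (da (2 * a2) x)
        (is_deriveMR (ds x) (da (3 * a3) x))))) (da T^-1 x).
    by apply: (is_derive_eq H); rewrite /w2; field.
  + move=> x; apply: cvgM; last exact: cvg_cst.
    apply: cvgM; last exact: cvg_cst.
    apply: cvgD; first exact: cvg_cst.
    by apply: cvgM; [exact: (is_derive_cont ds)|exact: cvg_cst].
- by split; rewrite /w /s /a0 /a1 /a2 /a3 /P /D /Q /S; field.
- by split; rewrite /w1 /s /a1 /a2 /a3 /P /D /Q /S; field.
move=> x xzT; have s1 : `|s x| <= 1.
  rewrite /s normrM normfV (@ger0_norm _ T); last by lra.
  by rewrite ler_pdivrMr ?mul1r ?ler_norml; lra.
have e0 : 0 <= eta by apply: le_trans hpl.
have TE : eta <= T * eta by rewrite ler_peMl.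
have hP : `|P| <= T * eta by move: hpl hpr; rewrite !ler_norml /P; lra.
have hD : `|D| <= T * eta by move: hpl hpr; rewrite !ler_norml /D; lra.
have hT (q : R) : `|q| <= eta -> `|q * T| <= T * eta.
  by move=> hq; rewrite mulrC normrM (@ger0_norm _ T) ?ler_wpM2l//; lra.
have hQ : `|Q| <= T * eta by apply: hT; move: hql hqr; rewrite !ler_norml /P; lra.
have hS : `|S| <= T * eta by apply: hT; move: hql hqr; rewrite !ler_norml /P; lra.
have ms (q m : R) : `|q| <= m -> `|s x * q| <= m.
  by move=> hq; rewrite normrM (le_trans _ hq)// ler_piMl.
have dT (q m : R) : `|q| <= m -> `|q / T| <= m.
  move=> hq; rewrite normrM normfV (@ger0_norm _ T); last by lra.
  rewrite ler_pdivrMr; last by lra.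
  by apply: (le_trans hq); rewrite ler_peMr// (le_trans _ hq).
rewrite -mulrA; move: (T * eta) hP hD hQ hS TE => M hP hD hQ hS TE.
have h0 : `|a0| <= 2 * M by move: hP hS; rewrite !ler_norml /a0; lra.
have h1 : `|a1| <= 2 * M by move: hD hQ; rewrite !ler_norml /a1; lra.
have h2 : `|a2| <= M by move: hS; rewrite !ler_norml /a2; lra.
have h3 : `|a3| <= M by move: hD hQ; rewrite !ler_norml /a3; lra.
have nD (q r m n : R) : `|q| <= m -> `|r| <= n -> `|q + r| <= m + n.
  by move=> hq hr; apply: le_trans (ler_normD _ _) _; exact: lerD.
have nM (q r m : R) : 0 <= q -> `|r| <= m -> `|q * r| <= q * m.
  by move=> q0 hr; rewrite normrM (ger0_norm q0) ler_wpM2l.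
have M0 : 0 <= M by apply: le_trans h2.
split.
- apply: le_trans (nD _ _ _ _ h0 (ms _ _ (nD _ _ _ _ h1 (ms _ _
    (nD _ _ _ _ h2 (ms _ _ h3)))))) _; clear -M0; lra.
- apply: le_trans (dT _ _ (nD _ _ _ _ h1 (ms _ _ (nD _ _ _ _
    (nM 2 _ _ _ h2) (ms _ _ (nM 3 _ _ _ h3)))))) _; clear -M0; lra.
- apply: le_trans (dT _ _ (dT _ _ (nD _ _ _ _ (nM 2 _ _ _ h2)
    (ms _ _ (nM 6 _ _ _ h3))))) _; clear -M0; lra.
Qed.

End H2Operations.

(** * The energy on compact intervals *)

Section EnergyOnIntervals.
Context {R : realType} (W : R -> R) (k0 k : R).
Hypotheses (dw : double_well W) (k0_gt0 : 0 < k0)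
  (NI : interpolation_ineq W k0) (k0k : 0 < k < k0).
Implicit Types (a b c s t x : R) (f g h : R -> R).
Local Notation mu := (@lebesgue_measure R).

Definition density f h x := W (f x) + h x ^+ 2.

Definition lagrangian f g h x := W (f x) - k * g x ^+ 2 + h x ^+ 2.

Definition energy_on f g h a b := Int a b (lagrangian f g h).

Local Notation E := energy_on.

Let kappa := 1 - k / k0.

Lemma kappa_gt0 : 0 < kappa.
Proof.
by rewrite subr_gt0 ltr_pdivrMr// mul1r; case/andP: k0k.
Qed.

Lemma W_ge0 s : 0 <= W s. Proof. by case: dw. Qed.

Lemma locint_W f : continuous f -> locint (W \o f).
Proof.
move=> cf; apply: locint_cont => x; apply: continuous_comp; first exact: cf.
by case: dw => cW _ _ _; exact: cW.
Qed.

Lemma locint_density f g h : H2 f g h -> locint (density f h).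
Proof.
move=> F; apply: locintD; first exact: locint_W (H2_cont F).
by case: (H2_L2 F).
Qed.

Lemma density_ge0 f h x : 0 <= density f h x.
Proof. by rewrite addr_ge0 ?W_ge0// sqr_ge0. Qed.

Lemma locint_sqr1 f g h : H2 f g h -> locint (fun x => g x ^+ 2).
Proof. by move=> /H2_cont1/L2loc_cont[]. Qed.

Lemma lagrangianE f g h x :
  lagrangian f g h x = density f h x - k * g x ^+ 2.
Proof. by rewrite /lagrangian /density addrAC. Qed.

Lemma locint_lagrangian f g h : H2 f g h -> locint (lagrangian f g h).
Proof.
move=> F; rewrite (_ : lagrangian f g h = fun x => density f h x - k * g x ^+ 2).
  by apply: locintB; [exact: locint_density F|exact/locintZ/locint_sqr1/F].
by apply/funext => x; exact: lagrangianE.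
Qed.

Lemma E_density f g h a b : H2 f g h ->
  E f g h a b = Int a b (density f h) - k * Int a b (fun x => g x ^+ 2).
Proof.
move=> F; rewrite -IntZ; last exact: locint_sqr1 F.
rewrite -IntB; last exact/locintZ/locint_sqr1/F; last exact: locint_density F.
by apply: eq_Int => x _; exact: lagrangianE.
Qed.

Lemma E_split b f g h a c : H2 f g h -> a <= b -> b <= c ->
  E f g h a c = E f g h a b + E f g h b c.
Proof. by move=> F ab bc; apply: Int_split => //; exact: locint_lagrangian. Qed.

Lemma interpolation_unit f g h a : H2 f g h ->
  k0 * Int a (a + 1) (fun x => g x ^+ 2) <= Int a (a + 1) (density f h).
Proof.
move=> F; have a1 : a < a + 1 by rewrite ltrDl.
have Eo u : locint u ->
    (\int[mu]_(x in `]a, (a + 1)%R[) (u x)%:E = (Int a (a + 1) u)%:E)%E.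
  move=> lu; rewrite -Int_oo// fineK//; apply: integrable_fin_num => //.
  by apply: integrableS (lu a (a + 1)) => //; exact: subset_itv_oo_cc.
have [_ /(_ _ _ a1) F22] := H2_W22loc F.
have lW := locint_W (H2_cont F); have [_ lh] := H2_L2 F.
have := NI a1 F22.
rewrite Eo; last exact: locint_sqr1 F.
rewrite (Eo (W \o f))// Eo// (_ : a + 1 - a = 1); last by ring.
by rewrite expr1n invr1 !mul1e -EFinM -EFinD lee_fin -IntD.
Qed.

Lemma interpolation_nat f g h a n : H2 f g h ->
  k0 * Int a (a + n%:R) (fun x => g x ^+ 2) <= Int a (a + n%:R) (density f h).
Proof.
move=> F; elim: n => [|n IH]; first by rewrite addr0 !Int_refl mulr0.
have an : a <= a + n%:R by rewrite lerDl.
have nn : a + n%:R <= a + n%:R + 1 by rewrite lerDl.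
rewrite -natr1 addrA (Int_split (locint_sqr1 F) an nn).
rewrite (Int_split (locint_density F) an nn) mulrDr lerD//.
exact: interpolation_unit.
Qed.

Lemma E_ge_density f g h a n : H2 f g h ->
  kappa * Int a (a + n%:R) (density f h) <= E f g h a (a + n%:R).
Proof.
move=> F; rewrite E_density//; have := interpolation_nat a n F.
set D := Int _ _ (density _ _); set G := Int _ _ _ => H.
have k_gt0 : 0 < k by case/andP: k0k.
suff : k * G <= k / k0 * D by rewrite /kappa; lra.
by rewrite -mulrA ler_pM2l// mulrC ler_pdivlMr// mulrC.
Qed.

Lemma E_ge0 f g h a n : H2 f g h -> 0 <= E f g h a (a + n%:R).
Proof.
move=> F; apply: le_trans (E_ge_density a n F); rewrite mulr_ge0 ?(ltW kappa_gt0)//.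
by apply: Int_ge0 => x _; exact: density_ge0.
Qed.

(** Integer lengths are needed: the energy of a short interval can be negative. *)
Lemma E_mono f g h s t (m n : nat) : H2 f g h -> s <= t ->
  E f g h s t <= E f g h (s - m%:R) (t + n%:R).
Proof.
move=> F st.
have ms : s - m%:R <= s by rewrite gerBl.
have tn : t <= t + n%:R by rewrite lerDl.
rewrite (E_split F ms (le_trans st tn)) (E_split F st tn).
have := E_ge0 t n F; have := E_ge0 (s - m%:R) m F; rewrite subrK; lra.
Qed.

(** By (N) the square of the derivative is integrable as soon as W(f) + h^2 is,
    so the energy is the difference of two finite integrals. *)
Lemma energy_fin f g h : H2 f g h -> (\int[mu]_x (density f h x)%:E < +oo)%E ->
  exists D G, [/\ (\int[mu]_x (density f h x)%:E = D%:E)%E,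
    (\int[mu]_x (g x ^+ 2)%:E = G%:E)%E & energy W k f g h = (D - k * G)%:E].
Proof.
move=> F Doo; have lD := locint_density F; have lG := locint_sqr1 F.
have D0 := @density_ge0 f h; have G0 x : 0 <= g x ^+ 2 by exact: sqr_ge0.
have DE : (\int[mu]_x (density f h x)%:E)%E \is a fin_num.
  by rewrite ge0_fin_numE// integral_ge0// => x _; rewrite lee_fin.
set D := fine (\int[mu]_x (density f h x)%:E)%E.
have DEq : D%:E = (\int[mu]_x (density f h x)%:E)%E by rewrite fineK.
have GD : (\int[mu]_x (g x ^+ 2)%:E <= (D / k0)%:E)%E.
  apply: (@integral_le_Int _ _ 0 0) => //; exists 0%N => n _.
  rewrite sub0r add0r ler_pdivlMr// mulrC.
  have := interpolation_nat (- n%:R) (n + n) F; rewrite natrD addrA addNr add0r.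
  move=> /le_trans; apply.
  by rewrite -lee_fin DEq; exact: Int_le_integral.
have GE : (\int[mu]_x (g x ^+ 2)%:E)%E \is a fin_num.
  rewrite ge0_fin_numE; first by apply: le_lt_trans GD _; exact: ltry.
  by apply: integral_ge0 => x _; rewrite lee_fin.
exists D, (fine (\int[mu]_x (g x ^+ 2)%:E)%E); split; rewrite ?fineK//.
rewrite /energy ifF; last first.
  by apply/negbTE; rewrite lt_eqF.
have iD : mu.-integrable setT (EFin \o density f h).
  apply/integrableP; split; first by apply/measurable_EFinP; exact: measurable_locint.
  by under eq_integral do rewrite /= ger0_norm//.
have iG : mu.-integrable setT (EFin \o (fun x => g x ^+ 2)).
  apply/integrableP; split; first by apply/measurable_EFinP; exact: measurable_locint.
  under eq_integral do rewrite /= ger0_norm//.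
  by rewrite -ge0_fin_numE// integral_ge0// => x _; rewrite lee_fin.
under eq_integral do rewrite -/(lagrangian f g h _) lagrangianE EFinB EFinM.
rewrite integralB//=; last exact: integrableZl.
by rewrite integralZl//= EFinB EFinM !fineK.
Qed.

Lemma energy_ge f g h a b : H2 f g h -> a <= b ->
  ((E f g h a b)%:E <= energy W k f g h)%E.
Proof.
move=> F ab; have lD := locint_density F; have lG := locint_sqr1 F.
have [Doo|] := ltP (\int[mu]_x (density f h x)%:E)%E +oo%E; last first.
  rewrite leye_eq => /eqP Doo; rewrite /energy ifT ?leey//.
  exact/eqP.
have [D [G [DE GE ->]]] := energy_fin F Doo.
have k_gt0 : 0 < k by case/andP: k0k.
rewrite lee_fin; suff : G <= (D - E f g h a b) / k.
  by rewrite ler_pdivlMr//; lra.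
rewrite -lee_fin -GE; apply: (@integral_le_Int _ _ a b) => //.
  by move=> x; exact: sqr_ge0.
exists 0%N => n _; rewrite ler_pdivlMr//.
have := E_mono n n F ab; rewrite (E_density (a - _))//.
have : Int (a - n%:R) (b + n%:R) (density f h) <= D.
  by rewrite -lee_fin -DE; apply: Int_le_integral => //; exact: density_ge0.
lra.
Qed.

(** The bound also rules out an infinite energy: W(f) + h^2 is controlled by the
    energy on intervals of integer length, uniformly. *)
Lemma energy_le f g h C : H2 f g h ->
  (exists N, forall n, (N <= n)%N -> E f g h (- n%:R) n%:R <= C) ->
  (energy W k f g h <= C%:E)%E.
Proof.
move=> F [N HN]; have lD := locint_density F; have lG := locint_sqr1 F.
have Doo : (\int[mu]_x (density f h x)%:E < +oo)%E.
  apply: (@le_lt_trans _ _ (C / kappa)%:E); last exact: ltry.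
  apply: (@integral_le_Int _ _ 0 0) => //; first exact: density_ge0.
  exists N => n Nn; rewrite sub0r add0r ler_pdivlMr ?kappa_gt0// mulrC.
  apply: le_trans (HN _ Nn).
  by have := E_ge_density (- n%:R) (n + n) F; rewrite natrD addrA addNr add0r.
have [D [G [DE GE ->]]] := energy_fin F Doo.
have k_gt0 : 0 < k by case/andP: k0k.
rewrite lee_fin; suff : D <= C + k * G by lra.
rewrite -lee_fin -DE; apply: (@integral_le_Int _ _ 0 0) => //.
  exact: density_ge0.
exists N => n /HN; rewrite E_density// sub0r add0r.
have : Int (- n%:R) n%:R (fun x => g x ^+ 2) <= G.
  rewrite -lee_fin -GE; apply: Int_le_integral => // x; exact: sqr_ge0.
nra.
Qed.

Lemma energy_ae f f1 g h : measurable_fun setT f1 -> H2 f g h ->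
  {ae mu, forall x, f1 x = g x} -> energy W k f f1 h = energy W k f g h.
Proof.
move=> mf1 F fg; rewrite /energy; case: ifP => // _.
have [mh lh] := H2_L2 F.
have mW : measurable_fun setT (W \o f).
  by apply: measurable_locint; exact: locint_W (H2_cont F).
have mL (u : R -> R) : measurable_fun setT u ->
    measurable_fun setT (fun x => W (f x) - k * u x ^+ 2 + h x ^+ 2).
  move=> mu_; apply: measurable_funD; last exact: measurable_funX.
  by apply: measurable_funB => //; apply: measurable_funM => //; exact: measurable_funX.
apply: ae_eq_integral => //.
- by apply/measurable_EFinP; exact: mL.
- apply/measurable_EFinP; apply: mL.
  by apply: continuous_measurable_fun; exact: H2_cont1 F.
- by apply: (@filterS _ _ (ae_filter_ringOfSetsType mu)) fg => x /= ->.
Qed.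

Lemma W22loc_normal_form f f1 f2 : W22loc f (f1, f2) ->
  exists2 g, H2 f g f2 & energy W k f f1 f2 = energy W k f g f2.
Proof.
move=> Hf; have [g [F fg]] := W22loc_H2 Hf; exists g => //.
apply: energy_ae => //.
by have [] : L2loc f1 by apply: L2loc_L2_on => a b ab; case: (Hf.2 a b ab).
Qed.

Lemma m_le f g h C : H2 f g h -> eventually_pm1 f ->
  (exists N, forall n, (N <= n)%N -> E f g h (- n%:R) n%:R <= C) ->
  (m_ W k <= C%:E)%E.
Proof.
move=> F Af /(energy_le F); apply: le_trans.
apply: ereal_inf_lbound; exists f, g, h; split => //; exact: H2_W22loc.
Qed.

End EnergyOnIntervals.

(** * Competitors *)

Section Competitors.
Context {R : realType} (W : R -> R) (k0 k : R).
Hypotheses (dw : double_well W) (k0_gt0 : 0 < k0)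
  (NI : interpolation_ineq W k0) (k0k : 0 < k < k0).
Implicit Types (a b c s t x : R) (f g h u v w : R -> R).
Local Notation mu := (@lebesgue_measure R).
Local Notation E := (energy_on W k).
Local Notation density := (density W).
Local Notation kappa := (1 - k / k0).

Lemma double_well_quadratic : exists2 c, 0 < c &
  forall s, c * (`|s| - 1) ^+ 2 <= W s.
Proof.
case: dw => _ _ _ [c c0 [cp cn]]; exists c => // s.
have [s0|/ltW s0] := leP 0 s; first by rewrite ger0_norm//; exact: cp.
by rewrite ler0_norm// -sqrrN opprB opprK addrC; exact: cn.
Qed.

Lemma W_well A : A = 1 \/ A = -1 -> W A = 0.
Proof.
case: dw => _ _ /seteqP[_ H] _ HA; apply: (H A).
by case: HA => ->; [right|left].
Qed.

(** If the integral were smaller than k0 / 4, then f' would have L^2 norm less than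
    1/2 by (N), so |f| would be at most 1/2 on the unit interval and W(f) at
    least c / 4. *)
Lemma zero_cost : exists2 d, 0 < d & forall f g h x, H2 f g h -> f x = 0 ->
  d <= Int x (x + 1) (density f h).
Proof.
have [c c0 Wc] := double_well_quadratic.
exists (Num.min (k0 / 4) (c / 4)); first by rewrite lt_min !divr_gt0.
move=> f g h x F fx; rewrite leNgt; apply/negP; rewrite lt_min => /andP[D1 D2].
have x1 : x <= x + 1 by rewrite lerDl.
have lD := locint_density dw F.
have := interpolation_unit dw NI x F.
set D := Int _ _ (density _ _) in D1 D2 *; set G := Int _ _ _ => GD.
have G4 : G < 1 / 4.
  by rewrite -(ltr_pM2l k0_gt0) (le_lt_trans GD)// mulrA mulr1.
have f2 y : x <= y <= x + 1 -> f y ^+ 2 <= 1 / 4.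
  move=> /andP[xy yx1].
  have := @sqr_dist_Int _ g f x (x + 1) x y (L2loc_cont (H2_cont1 F)).
  rewrite fx subr0 lexx xy yx1 x1 -/G => /(_ _ isT isT) H.
  apply: le_trans (H _) _; first by move=> s t; exact: H2_incr F.
  rewrite ger0_norm ?subr_ge0//.
  by have : 0 <= G; [apply: Int_ge0 => z _; exact: sqr_ge0|nra].
have : c / 4 * (x + 1 - x) <= D.
  apply: Int_ge_cst => // y xy; apply: (@le_trans _ _ (W (f y))).
    apply: le_trans (Wc _); rewrite ler_pM2l//.
    have : `|f y| <= 1 / 2.
      by rewrite -ler_sqr ?nnegrE ?divr_ge0// real_normK ?num_real// expr_div_n expr1n -natrX; exact: f2.
    have := normr_ge0 (f y); nra.
  by rewrite lerDl sqr_ge0.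
lra.
Qed.

Lemma E_glue_le t a b f g h f' g' h' : b <= t ->
  E (glue t f f') (glue t g g') (glue t h h') a b = E f g h a b.
Proof.
move=> bt; apply: eq_Int => x /andP[_ xb].
by rewrite /lagrangian !glue_le// (le_trans xb).
Qed.

Lemma E_glue_ge t a b f g h f' g' h' : H2 f g h -> H2 f' g' h' ->
  f t = f' t -> g t = g' t -> t <= a ->
  E (glue t f f') (glue t g g') (glue t h h') a b = E f' g' h' a b.
Proof.
move=> F F' ft gt ta; apply: eq_Int_oo.
- by apply: locint_lagrangian => //; exact: H2_glue.
- exact: locint_lagrangian.
- by move=> x /andP[ax _]; rewrite /lagrangian !glue_gt// (le_lt_trans ta).
Qed.

Lemma E_glue t a b f g h f' g' h' : H2 f g h -> H2 f' g' h' ->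
  f t = f' t -> g t = g' t -> a <= t -> t <= b ->
  E (glue t f f') (glue t g g') (glue t h h') a b =
  E f g h a t + E f' g' h' t b.
Proof.
move=> F F' ft gt at_ tb; rewrite (E_split k dw (H2_glue F F' ft gt) at_ tb).
by rewrite E_glue_le// E_glue_ge.
Qed.

Lemma E_well A a b : A = 1 \/ A = -1 -> a <= b ->
  E (fun=> A) (fun=> 0) (fun=> 0) a b = 0.
Proof.
move=> HA ab; rewrite /energy_on (@eq_Int _ _ _ _ (fun=> 0)) ?Int_cst ?mul0r//.
by move=> x _; rewrite /lagrangian W_well// expr0n/= mulr0 subrr addr0.
Qed.

Lemma E_le_density f g h a b : H2 f g h ->
  E f g h a b <= Int a b (density f h).
Proof.
move=> F; rewrite E_density// gerBl mulr_ge0//; first by case/andP: k0k => /ltW.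
by apply: Int_ge0 => x _; exact: sqr_ge0.
Qed.

(** The well A plus a small cubic: W is small near A by continuity, and the second
    derivative of the cubic is small with its boundary data.  The term in k has
    the favourable sign. *)
Lemma bridge e : 0 < e -> exists2 d, 0 < d &
  forall A t pl pr ql qr, A = 1 \/ A = -1 -> `|pl - A| <= d -> `|pr - A| <= d ->
  `|ql| <= d -> `|qr| <= d ->
  exists w w1 w2 : R -> R, [/\ H2 w w1 w2, w t = pl /\ w (t + 2) = pr,
    w1 t = ql /\ w1 (t + 2) = qr & E w w1 w2 t (t + 2) <= e].
Proof.
move=> e0; have cW : continuous W by case: dw.
have HW A : A = 1 \/ A = -1 ->
    exists2 r, 0 < r & forall s, `|s - A| < r -> W s < e / 4.
  move=> HA; have e4 : 0 < e / 4 by rewrite divr_gt0.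
  have /cvgrPdist_lt/(_ _ e4)/nbhs_ballP[r r0 H] := cW A.
  exists r => // s sA; have := H s; rewrite /ball/= distrC => /(_ sA).
  by rewrite (W_well HA) sub0r normrN => /(le_lt_trans (ler_norm _)).
have [r1 r10 H1] := HW 1 (or_introl erefl).
have [r2 r20 H2_] := HW (-1) (or_intror erefl).
pose d := Num.min (Num.min r1 r2) (Num.min 1 (e / 4)) / 21.
have m0 : 0 < Num.min (Num.min r1 r2) (Num.min 1 (e / 4)).
  by rewrite !lt_min r10 r20 ltr01 divr_gt0.
have d0 : 0 < d by rewrite divr_gt0.
have [dr1 [dr2 [d1 de]]] : 20 * d < r1 /\ 20 * d < r2 /\ 20 * d < 1 /\ 20 * d < e / 4.
  have : 20 * d < Num.min (Num.min r1 r2) (Num.min 1 (e / 4)) by rewrite /d; lra.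
  by rewrite !lt_min => /andP[/andP[-> ->] /andP[-> ->]].
exists d => // A t pl pr ql qr HA hpl hpr hql hqr.
have [w [w1 [w2 [Hw [wl wr] [w1l w1r] wb]]]] :=
  hermite (t + 1) (lexx 1) hpl hpr hql hqr.
have Et : t + 1 - 1 = t by ring.
have Et2 : t + 1 + 1 = t + 2 by ring.
rewrite Et Et2 in wl wr w1l w1r wb.
exists (fun x => A + w x), (fun x => 0 + w1 x), (fun x => 0 + w2 x).
have Hw' := H2D (H2_cst A) Hw; split => //.
- by rewrite wl wr; split; ring.
- by rewrite !add0r.
have tt2 : t <= t + 2 by rewrite lerDl.
apply: le_trans (E_le_density _ _ Hw') _.
have : Int t (t + 2) (density (fun x => A + w x) (fun x => 0 + w2 x)) <=
    e / 2 * (t + 2 - t).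
  apply: Int_le_cst => //; first exact: locint_density Hw'.
  move=> x /wb[]; rewrite mulr1 => b0 _ b2; rewrite /density add0r.
  have : W (A + w x) < e / 4.
    by case: HA => HA; rewrite HA in b0 *; [apply: H1|apply: H2_];
      rewrite addrAC subrr add0r; lra.
  have : w2 x ^+ 2 <= e / 4.
    rewrite -real_normK ?num_real//; have := normr_ge0 (w2 x); nra.
  lra.
lra.
Qed.

Lemma eventually_pm1_of_tails f s t : (forall x, x < s -> f x = -1) ->
  (forall x, t < x -> f x = 1) -> eventually_pm1 f.
Proof.
move=> fs ft; have s0 := normr_ge0 s; have t0 := normr_ge0 t.
have := ler_norm t; have := ler_norm (- s); rewrite normrN => sN tN.
exists (`|s| + `|t| + 1); first by lra.
by split=> x xT; [apply: ft|apply: fs]; lra.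
Qed.

Lemma large_itv s t : exists N, forall n, (N <= n)%N -> - n%:R <= s /\ t <= n%:R.
Proof.
have s0 := normr_ge0 s; have t0 := normr_ge0 t.
have := ler_norm t; have := ler_norm (- s); rewrite normrN => sN tN.
exists (Num.truncn (`|s| + `|t|)).+1 => n Hn.
have : `|s| + `|t| <= n%:R.
  by apply: le_trans (ltW (truncnS_gt _)) _; rewrite ler_nat.
by lra.
Qed.

(** Joining f to the constants -1 and 1 by bridges of length 2 produces a function
    of the class A whose energy exceeds the one of f on [s, t] by at most e. *)
Lemma m_le_near_wells e : 0 < e -> exists2 d, 0 < d & forall f g h s t, H2 f g h ->
  s <= t -> `|f s + 1| <= d -> `|g s| <= d -> `|f t - 1| <= d -> `|g t| <= d ->
  (m_ W k <= (E f g h s t + e)%:E)%E.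
Proof.
move=> e0; have [d d0 Hd] := bridge (divr_gt0 e0 (ltr0n _ 2)).
exists d => // f g h s t F st fs gs ft gt.
have d0' : `|(0 : R)| <= d by rewrite normr0 ltW.
have dd (x : R) : `|x - x| <= d by rewrite subrr.
have fs' : `|f s - -1| <= d by rewrite opprK.
have [l [l1 [l2 [L [ll lr] [l1l l1r] lE]]]] :=
  Hd (-1) (s - 2) (-1) (f s) 0 (g s) (or_intror erefl) (dd _) fs' d0' gs.
have [r [r1 [r2 [Rr [rl rr] [r1l r1r] rE]]]] :=
  Hd 1 t (f t) 1 (g t) 0 (or_introl erefl) ft (dd _) gt d0'.
rewrite subrK in lr l1r lE.
pose cst1 := H2_cst (1 : R); pose cstN1 := H2_cst (-1 : R).
have R1 := H2_glue Rr cst1 rr r1r.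
set ru := glue _ r _ in R1; set ru1 := glue _ r1 _ in R1; set ru2 := glue _ r2 _ in R1.
have t2 : t <= t + 2 by rewrite lerDl.
have s2 : s - 2 <= s by rewrite gerBl.
have rut : f t = ru t by rewrite /ru glue_le.
have ru1t : g t = ru1 t by rewrite /ru1 glue_le.
have R2 := H2_glue F R1 rut ru1t.
set fr := glue _ f _ in R2; set fr1 := glue _ g _ in R2; set fr2 := glue _ h _ in R2.
have L1 := H2_glue cstN1 L (esym ll) (esym l1l).
set lu := glue _ _ l in L1; set lu1 := glue _ _ l1 in L1; set lu2 := glue _ _ l2 in L1.
have lus : lu s = fr s by rewrite /lu glue_ge// /fr glue_le.
have lu1s : lu1 s = fr1 s by rewrite /lu1 glue_ge// /fr1 glue_le.
have U := H2_glue L1 R2 lus lu1s.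
apply: (m_le dw k0_gt0 NI k0k U).
  apply: (@eventually_pm1_of_tails _ (s - 2) (t + 2)) => x xT.
    by rewrite glue_le ?(le_trans (ltW xT))// /lu glue_le// ltW.
  have tx : t < x by exact: le_lt_trans xT.
  by rewrite glue_gt ?(le_lt_trans st)// /fr glue_gt// /ru glue_gt.
have [N HN] := large_itv (s - 2) (t + 2).
exists N => n /HN[b1 b2].
have b3 := le_trans b1 s2; have b4 := le_trans t2 b2; have b5 := le_trans st b4.
rewrite (E_glue L1 R2 lus lu1s b3 b5) (E_glue F R1 rut ru1t st b4).
rewrite (E_glue Rr cst1 rr r1r t2 b2).
rewrite (E_glue cstN1 L (esym ll) (esym l1l) b1 s2).
rewrite !E_well ?add0r ?addr0//; [|by left|by right].
by move: lE rE; clear; lra.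
Qed.

(** Otherwise replacing f by u on [s, t] would lower its energy below M. *)
Lemma E_near_minimal M e f g h u v w s t : (m_ W k = M%:E)%E ->
  H2 f g h -> eventually_pm1 f -> (forall a b, a <= b -> E f g h a b <= M + e) ->
  H2 u v w -> s <= t -> f s = u s -> g s = v s -> f t = u t -> g t = v t ->
  E f g h s t <= E u v w s t + e.
Proof.
move=> mM F [T T0 [fR fL]] fE U st fs gs ft gt.
have G1 := H2_glue U F (esym ft) (esym gt).
set y := glue _ u _ in G1; set y1 := glue _ v _ in G1; set y2 := glue _ w _ in G1.
have ys : f s = y s by rewrite /y glue_le.
have y1s : g s = y1 s by rewrite /y1 glue_le.
have G := H2_glue F G1 ys y1s.
rewrite -(lerD2l (M - E f g h s t)) (_ : _ - _ + _ = M); last by ring.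
rewrite -lee_fin -mM; apply: (m_le dw k0_gt0 NI k0k G).
  apply: (@eventually_pm1_of_tails _ (Num.min s (- T)) (Num.max t T)) => x.
    by rewrite lt_min => /andP[xs xT]; rewrite glue_le ?fL// ltW.
  rewrite gt_max => /andP[tx Tx].
  by rewrite glue_gt ?(le_lt_trans st)// /y glue_gt// fR.
have [N HN] := large_itv s t; exists N => n /HN[b3 b4].
have b5 := le_trans st b4.
rewrite (E_glue F G1 ys y1s b3 b5) (E_glue U F (esym ft) (esym gt) st b4).
have := fE _ _ (le_trans b3 b5).
rewrite (E_split k dw F b3 b5) (E_split k dw F st b4); clear; lra.
Qed.

Lemma m_gt0 : (0 < m_ W k)%E.
Proof.
have [d d0 Hd] := zero_cost.
have kp := kappa_gt0 k0_gt0 k0k.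
apply: (@lt_le_trans _ _ (kappa * d)%:E); first by rewrite lte_fin mulr_gt0.
apply: le_ereal_inf_tmp => _ [f [f1 [f2 [Hf [T T0 [fR fL]] ->]]]].
have [g F ->] := W22loc_normal_form k dw Hf.
have TT : - (T + 1) <= T + 1 by lra.
have cf : {within `[- (T + 1), T + 1], continuous f}.
  by apply: continuous_subspaceT; exact: H2_cont F.
have f0 : Num.min (f (- (T + 1))) (f (T + 1)) <= 0 <=
    Num.max (f (- (T + 1))) (f (T + 1)).
  by rewrite (fL (- (T + 1))) ?(fR (T + 1)) ?ge_min ?le_max; lra.
have [x _ fx] := IVT TT cf f0.
apply: le_trans (energy_ge dw k0_gt0 NI k0k F (_ : x <= x + 1%:R)); last first.
  by rewrite lerDl.
rewrite lee_fin; apply: le_trans (E_ge_density dw k0_gt0 NI k0k _ _ F).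
by rewrite ler_pM2l//; apply: Hd F fx.
Qed.

Lemma m_lty : (m_ W k < +oo)%E.
Proof.
have [d d0 Hd] := m_le_near_wells ltr01.
have n1 : `|(-1 : R)| <= 1 by rewrite normrN1.
have n2 : `|(1 : R)| <= 1 by rewrite normr1.
have n3 : `|(0 : R)| <= 1 by rewrite normr0.
have [w [w1 [w2 [Hw [wl wr] [w1l w1r] _]]]] := hermite 0 (lexx (1 : R)) n1 n2 n3 n3.
rewrite sub0r add0r in wl wr w1l w1r.
apply: le_lt_trans (Hd w w1 w2 (-1) 1 Hw _ _ _ _ _) (ltry _).
- lra.
- by rewrite wl addNr normr0 ltW.
- by rewrite w1l normr0 ltW.
- by rewrite wr subrr normr0 ltW.
- by rewrite w1r normr0 ltW.
Qed.

(** The mean value theorem on an interval of length 1 where f varies little. *)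
Lemma flat_point f g h A a d : H2 f g h ->
  (forall x, a <= x <= a + 1 -> `|f x - A| <= d / 2) ->
  exists x, [/\ a <= x <= a + 1, `|f x - A| <= d & `|g x| <= d].
Proof.
move=> F fA; have a1 : a < a + 1 by rewrite ltrDl.
have df x : x \in `]a, a + 1[ -> is_derive x 1 f (g x) by case: F.
have cf : {within `[a, a + 1], continuous f}.
  by apply: continuous_subspaceT; exact: H2_cont F.
have [x] := MVT a1 df cf.
rewrite in_itv/= => /andP[ax xa] fg; exists x.
have xa1 : a <= x <= a + 1 by rewrite !ltW.
have d0 : 0 <= d by have := le_trans (normr_ge0 _) (fA _ xa1); lra.
split => //; first by apply: le_trans (fA _ xa1) _; lra.
have -> : g x = (f (a + 1) - A) - (f a - A) by move: fg; lra.
apply: le_trans (ler_normB _ _) _.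
have := fA a; have := fA (a + 1); rewrite !lexx (ltW a1) => /(_ isT) + /(_ isT).
lra.
Qed.

Lemma m_le_energy_limits f g h : H2 f g h -> limits_pm1 f ->
  (m_ W k <= energy W k f g h)%E.
Proof.
move=> F [fL fR]; apply/lee_addgt0Pr => e e0.
have [d d0 Hd] := m_le_near_wells e0; have d2 : 0 < d / 2 by rewrite divr_gt0.
have [X1 [_ HX1]] : \forall x \near +oo, `|1 - f x| < d / 2.
  by move/cvgrPdist_lt : fR; exact.
have [X2 [_ HX2]] : \forall x \near -oo, `|-1 - f x| < d / 2.
  by move/cvgrPdist_lt : fL; exact.
have [t [tX ft gt]] : exists x, [/\ `|X1| + 1 <= x <= `|X1| + 1 + 1,
    `|f x - 1| <= d & `|g x| <= d].
  apply: (flat_point F) => x /andP[xX _]; rewrite distrC ltW//; apply: HX1.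
  by have := ler_norm X1; lra.
have [s [sX fs gs]] : exists x, [/\ - `|X2| - 2 <= x <= - `|X2| - 2 + 1,
    `|f x - (-1)| <= d & `|g x| <= d].
  apply: (flat_point F) => x /andP[_ xX]; rewrite distrC ltW//; apply: HX2.
  by have := ler_norm (- X2); rewrite normrN; lra.
rewrite opprK in fs.
have st : s <= t.
  by have := normr_ge0 X1; have := normr_ge0 X2; move: tX sX; lra.
apply: le_trans (Hd f g h s t F st fs gs ft gt) _.
by rewrite EFinD leeD2r//; exact: (energy_ge dw k0_gt0 NI k0k F st).
Qed.

End Competitors.

(** * Completeness of local L2 convergence *)

Section L2Completeness.
Context {R : realType}.
Implicit Types (a b : R).
Local Notation mu := (@lebesgue_measure R).

(** The integral of the series of absolute values is finite. *)
Lemma ae_cvg_series (u : nat -> R -> R) a b : (forall n, locint (u n)) ->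
  (forall n, Int a b (fun x => `|u n x|) <= 2 / 2 ^+ n.+1) ->
  {ae mu, forall x, `[a, b]%classic x -> cvgn (series (u^~ x))}.
Proof.
move=> lu uC; pose f n x := (`|u n x|)%:E.
have mf n : measurable_fun `[a, b] (f n).
  by have := locint_norm (lu n); move=> /(_ a b) /measurable_int.
have f0 n x : `[a, b]%classic x -> (0 <= f n x)%E by rewrite lee_fin.
have SE : (\int[mu]_(x in `[a, b]) \sum_(0 <= n <oo) f n x < +oo)%E.
  rewrite integral_nneseries//; apply: (@le_lt_trans _ _ 2%:E); last exact: ltry.
  apply: le_trans (@epsilon_trick0 R 2 xpredT _) => //.
  apply: lee_nneseries => [n _ _|n _]; first by apply: integral_ge0 => x; exact: f0.
  by rewrite -EFin_Int ?natrX ?lee_fin//; exact/locint_norm/lu.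
have S0 x : `[a, b]%classic x -> (0 <= \sum_(0 <= n <oo) f n x)%E.
  by move=> xab; apply: nneseries_ge0 => n _ _; exact: f0.
have iS : mu.-integrable `[a, b] (fun x => \sum_(0 <= n <oo) f n x)%E.
  apply/integrableP; split.
    apply: (@ge0_emeasurable_sum _ _ _ _ f xpredT) => //.
    by move=> n x xab _; exact: f0.
  apply: le_lt_trans SE; rewrite le_eqVlt; apply/orP; left; apply/eqP.
  by apply: eq_integral => x; rewrite inE => xab; rewrite gee0_abs// S0.
have := (fun mab => integrable_ae mab iS) (measurable_itv _).
apply: (@filterS _ _ (ae_filter_ringOfSetsType mu)) => x /= H xab.
have {}H := H xab.
apply: normed_cvg; apply: nondecreasing_is_cvgn.
  by apply: nondecreasing_series => i _ _; exact: normr_ge0.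
exists (fine (\sum_(0 <= n <oo) f n x)%E) => _ [n _ <-].
rewrite -lee_fin fineK// /series/= -sumEFin.
by apply: nneseries_lim_ge => i _ _; rewrite lee_fin.
Qed.

(** Stated in the extended reals, because the integrability of v is one of its
    consequences. *)
Lemma Fatou_Int (u : nat -> R -> R) (v : R -> R) a b (C : R) : (forall n, locint (u n)) ->
  (forall n x, 0 <= u n x) -> measurable_fun setT v ->
  {ae mu, forall x, `[a, b]%classic x -> u n x @[n --> \oo] --> v x} ->
  (forall n, Int a b (u n) <= C) ->
  (\int[mu]_(x in `[a, b]) `|v x|%:E <= C%:E)%E.
Proof.
move=> lu u0 mv uv uC.
have mu_ n : measurable_fun `[a, b] (EFin \o u n).
  by have /measurable_int := lu n a b.
have := @fatou _ _ R mu `[a, b]%classic (measurable_itv _) (fun n x => (u n x)%:E)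
  mu_ (fun n x _ => u0 n x).
have -> : (\int[mu]_(x in `[a, b]) limn_einf (fun n => (u n x)%:E) =
           \int[mu]_(x in `[a, b]) `|v x|%:E)%E.
  apply: ge0_ae_eq_integral => //.
  - rewrite /limn_einf; apply: measurableT_comp => //.
    apply: (@measurable_fun_limn_esup _ _ _ _ (fun n x => (- (u n x)%:E)%E)) => n.
    apply/measurable_EFinP; apply: measurableT_comp => //.
    by have /measurable_EFinP := mu_ n.
  - by apply/measurable_EFinP/measurable_funTS; exact: measurableT_comp.
  - move=> x _; rewrite limn_einf_lim; apply: lime_ge; first exact: is_cvg_einfs.
    by apply: nearW => n; apply: le_ereal_inf_tmp => _ [m _ <-]; rewrite lee_fin.
  - apply: (@filterS _ _ (ae_filter_ringOfSetsType mu)) uv => x /= H xab.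
    have {}H := H xab.
    have v0 : 0 <= v x.
      by apply: (cvgr_to_ge H); apply: nearW => n; exact: u0.
    have Hx : (u n x)%:E @[n --> \oo] --> (v x)%:E by apply: cvg_EFin => //; exact: nearW.
    rewrite is_cvg_limn_einfE; last by apply/cvg_ex; eexists; exact: Hx.
    by rewrite (cvg_lim _ Hx)// ger0_norm.
move=> /le_trans; apply.
rewrite limn_einf_lim; apply: lime_le; first exact: is_cvg_einfs.
apply: nearW => n; apply: le_trans (_ : ((Int a b (u n))%:E <= _)%E).
  by apply: ereal_inf_lbound; exists n => //=; rewrite EFin_Int.
by rewrite lee_fin.
Qed.

End L2Completeness.

Section L2Complete.
Context {R : realType}.
Implicit Types (a b e : R).
Local Notation mu := (@lebesgue_measure R).

Section Subsequence.
Variables (h : nat -> R -> R) (tau : nat -> nat) (l : R -> R).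
Hypotheses (lh : forall n, L2loc (h n))
  (fast : forall T n, (T <= n)%N ->
     Int (- T%:R) T%:R (fun x => (h (tau n.+1) x - h (tau n) x) ^+ 2) <=
     (2^-1 ^+ n) ^+ 2 / (2 * n%:R + 1))
  (lE : forall x (y : R), h (tau n) x @[n --> \oo] --> y -> l x = y).

(** The rate of [fast] makes the L^1(-T, T) norms of the increments summable. *)
Lemma ae_cvg_fast (T : nat) :
  {ae mu, forall x, `[- T%:R, T%:R]%classic x -> h (tau n) x @[n --> \oo] --> l x}.
Proof.
pose u n x := h (tau (n + T).+1) x - h (tau (n + T)%N) x.
have lu n : L2loc (u n) by exact: L2locB.
have TT : - T%:R <= T%:R :> R by have := ler0n R T; lra.
have uC n : Int (- T%:R) T%:R (fun x => `|u n x|) <= 2 / 2 ^+ n.+1.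
  have lnu : L2loc (fun x => `|u n x|).
    split; first by apply: measurableT_comp => //; case: (lu n).
    by under [X in locint X]funext do rewrite real_normK ?num_real//; case: (lu n).
  have I0 : 0 <= Int (- T%:R) T%:R (fun x => `|u n x|) by exact: Int_ge0.
  have HS := Cauchy_Schwarz TT lnu.
  have EQ : Int (- T%:R) T%:R (fun x => `|u n x| ^+ 2) =
      Int (- T%:R) T%:R (fun x => u n x ^+ 2).
    by apply: eq_Int => x _; rewrite real_normK ?num_real.
  rewrite {}EQ in HS.
  set S := Int _ _ (fun x => `|_|) in I0 HS *.
  set Q := Int _ _ (fun x => u n x ^+ 2) in HS.
  have {}HQ : Q <= (2^-1 ^+ (n + T)) ^+ 2 / (2 * (n + T)%:R + 1).
    exact: fast (leq_addl n T).
  set p : R := 2^-1 ^+ (n + T) in HQ.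
  have p0 : 0 <= p by rewrite exprn_ge0 ?invr_ge0.
  have pn : p <= 2 / 2 ^+ n.+1.
    rewrite exprS invfM mulrA divff ?mul1r ?pnatr_eq0// -exprVn /p exprD.
    by rewrite ler_piMr ?exprn_ge0 ?invr_ge0// exprn_ile1 ?invr_ge0// invf_le1// ler1n.
  apply: le_trans pn; rewrite -ler_sqr ?nnegrE//; apply: le_trans HS _.
  have D0 : 0 < 2 * (n + T)%:R + 1 :> R by have := ler0n R (n + T); lra.
  have Q0 : 0 <= Q by apply: Int_ge0 => x _; rewrite sqr_ge0.
  rewrite ler_pdivlMr// in HQ.
  have : T%:R <= (n + T)%:R :> R by rewrite ler_nat leq_addl.
  nra.
have := ae_cvg_series (fun n => L2loc_locint (lu n)) uC.
apply: (@filterS _ _ (ae_filter_ringOfSetsType mu)) => x /= H xT.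
have {H} := H xT.
have -> : u ^~ x = telescope (fun n => h (tau (n + T)%N) x).
  by apply/funext => n; rewrite /telescope/= /u addSn.
rewrite telescopeK => /cvg_ex[/= y Hy].
have {}Hy : h (tau (n + T)%N) x @[n --> \oo] --> y + h (tau (0 + T)%N) x.
  rewrite (_ : (fun n => _) =
    (fun n => (h (tau (n + T)%N) x - h (tau (0 + T)%N) x) + h (tau (0 + T)%N) x)).
    by apply: cvgD => //; exact: cvg_cst.
  by apply/funext => n; rewrite subrK.
move: Hy; rewrite (cvg_shiftn T (fun n => h (tau n) x)) => Hy.
by rewrite (lE Hy).
Qed.

End Subsequence.

(** As in the Riesz-Fischer theorem: a fast subsequence converges almost
    everywhere, and Fatou's lemma bounds the distance to its limit.  The upper
    limit provides a measurable representative defined everywhere. *)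
Lemma L2loc_complete (h : nat -> R -> R) : (forall n, L2loc (h n)) ->
  (forall (T : nat) e, 0 < e -> exists J, forall i j, (J <= i)%N -> (J <= j)%N ->
     Int (- T%:R) T%:R (fun x => (h i x - h j x) ^+ 2) <= e) ->
  exists l, L2loc l /\ forall (T : nat) e, 0 < e -> exists J, forall j, (J <= j)%N ->
     Int (- T%:R) T%:R (fun x => (h j x - l x) ^+ 2) <= e.
Proof.
move=> lh cauchy.
pose eps (n : nat) : R := (2^-1 ^+ n) ^+ 2 / (2 * n%:R + 1).
have eps0 n : 0 < eps n.
  by rewrite divr_gt0 ?exprn_gt0 ?invr_gt0.
have /choice[K HK] := fun n => cauchy n (eps n) (eps0 n).
pose tau n := (\sum_(i < n.+1) K i + n)%N.
have Ktau n : (K n <= tau n)%N.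
  by rewrite /tau big_ord_recr/= addnAC leq_addl.
have tauS n : (tau n <= tau n.+1)%N.
  by rewrite /tau [X in (_ <= X + _)%N]big_ord_recr/= leq_add// leq_addr.
have tau_ge n : (n <= tau n)%N by rewrite leq_addl.
pose l x := fine (limn_esup (fun n => (h (tau n) x)%:E)).
have lE x (y : R) : h (tau n) x @[n --> \oo] --> y -> l x = y.
  move=> Hy; have Hx : (h (tau n) x)%:E @[n --> \oo] --> y%:E.
    by apply: cvg_EFin => //; exact: nearW.
  rewrite /l is_cvg_limn_esupE; last by apply/cvg_ex; eexists; exact: Hx.
  by rewrite (cvg_lim _ Hx).
have ml : measurable_fun setT l.
  apply: (measurableT_comp (fine_measurable measurableT)).
  apply: (@measurable_fun_limn_esup _ _ _ _ (fun n x => (h (tau n) x)%:E)) => n.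
  by apply/measurable_EFinP; case: (lh (tau n)).
have fast T n : (T <= n)%N ->
    Int (- T%:R) T%:R (fun x => (h (tau n.+1) x - h (tau n) x) ^+ 2) <= eps n.
  move=> Tn; apply: le_trans (HK n (tau n.+1) (tau n) _ _) => //; last first.
    exact: leq_trans (tauS n).
  have TnR : T%:R <= n%:R :> R by rewrite ler_nat.
  have T0 := ler0n R T.
  apply: le_Int_itv; [|by move=> x; exact: sqr_ge0|lra|lra|lra].
  by case: (L2locB (lh (tau n.+1)) (lh (tau n))).
have Fat (T : nat) e J : (forall i j, (J <= i)%N -> (J <= j)%N ->
     Int (- T%:R) T%:R (fun x => (h i x - h j x) ^+ 2) <= e) ->
   forall j, (J <= j)%N ->
   (\int[mu]_(x in `[(- T%:R)%R, T%:R%R]) `|(h j x - l x) ^+ 2|%:E <= e%:E)%E.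
  move=> HJ j Jj.
  apply: (@Fatou_Int _ (fun n x => (h j x - h (tau (n + J)%N) x) ^+ 2)).
  - by move=> n; case: (L2locB (lh j) (lh (tau (n + J)%N))).
  - by move=> n x; exact: sqr_ge0.
  - by apply: measurable_funX; apply: measurable_funB => //; case: (lh j).
  - have := @ae_cvg_fast h tau l lh fast lE T.
    apply: (@filterS _ _ (ae_filter_ringOfSetsType mu)) => x /= H xT.
    have {}H := H xT.
    have {}H : h (tau (n + J)%N) x @[n --> \oo] --> l x.
      by move: H; rewrite -(cvg_shiftn J (fun n => h (tau n) x)).
    by apply: cvgM; apply: cvgB => //; exact: cvg_cst.
  - move=> n; apply: HJ => //; apply: leq_trans (tau_ge _); exact: leq_addl.
have l2l : L2loc l.
  split => // a b.
  pose T := (Num.truncn (`|a| + `|b|)).+1.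
  have := truncnS_gt (`|a| + `|b|); rewrite -/T => HT.
  have := ler_norm b; have := ler_norm (- a); rewrite normrN => na nb.
  have na0 := normr_ge0 a; have nb0 := normr_ge0 b.
  have [J HJ] := cauchy T 1 ltr01.
  have F := Fat T 1 J HJ J (leqnn J).
  have md : measurable_fun setT (fun x => (h J x - l x) ^+ 2).
    by apply: measurable_funX; apply: measurable_funB => //; case: (lh J).
  have id_ : mu.-integrable `[- T%:R, T%:R] (EFin \o (fun x => (h J x - l x) ^+ 2)).
    apply/integrableP; split.
      by apply/measurable_EFinP; exact: measurable_funTS.
    by apply: le_lt_trans F _; exact: ltry.
  apply: (@integrableS _ _ _ mu `[- T%:R, T%:R]) => //.
    by move=> x /=; rewrite !in_itv/=; lra.
  have [_ lh2] := lh J.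
  apply: le_integrable (integrableD _ (locintZ 2 lh2 _ _) (integrableZl _ 2 id_)) => //.
    by apply/measurable_EFinP/measurable_funTS; exact: measurable_funX.
  move=> x _ /=; rewrite lee_fin !ger0_norm ?sqr_ge0//.
    rewrite -subr_ge0 (_ : _ - _ = (2 * h J x - l x) ^+ 2) ?sqr_ge0//; ring.
  by rewrite addr_ge0// mulr_ge0// sqr_ge0.
exists l; split => // T e e0; have [J HJ] := cauchy T e e0; exists J => j Jj.
rewrite -lee_fin EFin_Int; last by case: (L2locB (lh j) l2l).
apply: le_trans (Fat T e J HJ j Jj); rewrite le_eqVlt; apply/orP; left; apply/eqP.
by apply: eq_integral => x _; rewrite ger0_norm// sqr_ge0.
Qed.

End L2Complete.

(** * Compactness of minimizing sequences *)

Section ArzelaAscoli.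
Context {R : realType}.
Implicit Types (e d x y : R) (u : nat -> R -> R).

Definition equicontinuous_seq u := forall e, 0 < e -> exists2 d, 0 < d &
  forall n x y, `|x - y| <= d -> `|u n x - u n y| <= e.

Lemma ultra_bounded_cvg (G : set_system nat) (w : nat -> R) (B : R) :
  UltraFilter G -> (forall n, `|w n| <= B) -> exists l : R, w n @[n --> G] --> l.
Proof.
move=> UG wB.
have wI : (w @ G) `[- B, B]%classic.
  by apply: nearW => n; rewrite /= in_itv/= -ler_norml.
have [l [_ cl]] := @segment_compact R (- B) B _ _ wI.
exists l => V Vl.
have [//|GV] := in_ultra_setVsetC (w @^-1` V) UG.
by have [y [/= nVy Vy]] := cl (~` V) V GV Vl.
Qed.

(** Equicontinuity reduces the claim to the finitely many points of a grid of
    step d, and a filter is stable under finite intersections. *)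
Lemma ultra_unif_cvg (G : set_system nat) u (v : R -> R) :
  ProperFilter G -> equicontinuous_seq u ->
  (forall x, u n x @[n --> G] --> v x) ->
  forall (N : nat) e, 0 < e ->
  \forall n \near G, forall x, `|x| <= N%:R -> `|u n x - v x| <= e.
Proof.
move=> PG equ uv N e e0; have e3 : 0 < e / 3 by rewrite divr_gt0.
have [d d0 ud] := equ _ e3.
have vd x y : `|x - y| <= d -> `|v x - v y| <= e / 3.
  move=> xy; have H : `|u n x - u n y| @[n --> G] --> `|v x - v y|.
    by apply: cvg_norm; apply: cvgB; exact: uv.
  by apply: (cvgr_to_le H); apply: nearW => n; exact: ud.
pose z (i : nat) := - N%:R + i%:R * d.
pose K := (Num.truncn (2 * N%:R / d)).+1.
have HK : \forall n \near G, forall i, (i < K)%N -> `|u n (z i) - v (z i)| <= e / 3.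
  elim: K => [|K IH]; first exact: nearW.
  have /cvgrPdist_le/(_ _ e3) HK := uv (z K).
  near=> n => i; rewrite ltnS leq_eqVlt => /predU1P[->|iK].
    by rewrite distrC; near: n.
  by move: i iK; near: n.
near=> n => x; rewrite ler_norml => /andP[xN1 xN2].
have q0 : 0 <= (x + N%:R) / d by rewrite divr_ge0 ?(ltW d0)//; lra.
pose i := Num.truncn ((x + N%:R) / d).
have /andP[i1 i2] := truncn_itv q0; rewrite -/i in i1 i2.
rewrite ler_pdivlMr// in i1; rewrite ltr_pdivrMr// -natr1 mulrDl mul1r in i2.
have iK : (i < K)%N.
  rewrite ltnS le_truncn// ler_pM2r ?invr_gt0//; lra.
have xz : `|x - z i| <= d by rewrite ler_norml /z; lra.
have h1 := ud n _ _ xz; have h2 := vd _ _ xz.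
have h3 : `|u n (z i) - v (z i)| <= e / 3.
  by move: i iK {i1 i2 xz h1 h2}; near: n.
move: h1 h2 h3; rewrite !ler_norml; lra.
Unshelve. all: by end_near. Qed.

(** Along an ultrafilter every bounded sequence converges, so that the pointwise
    limits are obtained for all points at once, without a diagonal argument;
    local uniformity then lets a sequence be extracted. *)
Lemma Arzela_Ascoli u u' (B : R -> R) :
  equicontinuous_seq u -> equicontinuous_seq u' ->
  (forall n x, `|u n x| <= B x) -> (forall n x, `|u' n x| <= B x) ->
  exists (sigma : nat -> nat) (v v' : R -> R), forall j, (j <= sigma j)%N /\
    forall x, `|x| <= j%:R -> `|u (sigma j) x - v x| <= j.+1%:R^-1 /\
      `|u' (sigma j) x - v' x| <= j.+1%:R^-1.
Proof.
move=> equ equ' uB uB'.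
have [G [UG sG]] := @ultraFilterLemma nat \oo _.
have PG : ProperFilter G by exact: ultra_proper.
have /choice[v Hv] := fun x => ultra_bounded_cvg UG (uB^~ x).
have /choice[v' Hv'] := fun x => ultra_bounded_cvg UG (uB'^~ x).
have H (j : nat) : exists n, (j <= n)%N /\
    forall x, `|x| <= j%:R -> `|u n x - v x| <= j.+1%:R^-1 /\
      `|u' n x - v' x| <= j.+1%:R^-1.
  have j0 : 0 < j.+1%:R^-1 :> R by rewrite invr_gt0.
  apply: (@filter_ex _ G).
  have A1 := ultra_unif_cvg PG equ Hv j j0.
  have A2 := ultra_unif_cvg PG equ' Hv' j j0.
  have A3 : \forall n \near G, (j <= n)%N by apply: sG; exact: nbhs_infty_ge.
  near=> n; split; first by near: n.
  move=> x xj; split.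
    by move: x xj; near: n.
  by move: x xj; near: n.
have /choice[sigma Hs] := H.
by exists sigma, v, v'.
Unshelve. all: by end_near. Qed.

End ArzelaAscoli.

Section MinimizingSequence.
Context {R : realType} (W : R -> R) (k0 k : R).
Hypotheses (dw : double_well W) (k0_gt0 : 0 < k0)
  (NI : interpolation_ineq W k0) (k0k : 0 < k < k0).
Implicit Types (a b c s t x : R) (f g h u v w : R -> R).
Local Notation mu := (@lebesgue_measure R).
Local Notation E := (energy_on W k).
Local Notation density := (density W).
Local Notation kappa := (1 - k / k0).

Lemma E_shift c f g h a b : H2 f g h ->
  E (fun x => f (x + c)) (fun x => g (x + c)) (fun x => h (x + c)) a b =
  E f g h (a + c) (b + c).
Proof.
by move=> F; exact: (esym (Int_shift c a b (locint_lagrangian k dw F))).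
Qed.

(** z is the supremum of the zero set; a negative value to its right would create
    a zero beyond z, by the intermediate value theorem. *)
Lemma last_zero f T : continuous f -> (forall x, T < x -> f x = 1) ->
  (exists x, f x = 0) -> exists2 z, f z = 0 & forall x, z <= x -> 0 <= f x.
Proof.
move=> cf fT [x0 fx0]; pose Z := [set x | f x = 0].
have ubZ : ubound Z T.
  move=> x Zx; rewrite leNgt; apply/negP => /fT; rewrite Zx => /eqP.
  by rewrite eq_sym oner_eq0.
have hZ : has_sup Z by split; [exists x0|exists T].
have Zs : Z (sup Z).
  have clZ : closed Z.
    apply: (@closed_comp _ _ f [set 0]); last exact: closed_eq.
    by move=> x _; exact: cf.
  by apply: clZ; apply: closure_sup; case: hZ.
exists (sup Z) => // x zx; rewrite leNgt; apply/negP => fx.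
have xT : x <= T.
  by rewrite leNgt; apply/negP => /fT fx1; move: fx; rewrite fx1 ltr10.
have xT1 : x <= T + 1 by lra.
have cf' : {within `[x, T + 1], continuous f} by exact: continuous_subspaceT.
have f0 : Num.min (f x) (f (T + 1)) <= 0 <= Num.max (f x) (f (T + 1)).
  by rewrite (fT (T + 1)) ?ge_min ?le_max; lra.
have [y] := IVT xT1 cf' f0; rewrite in_itv/= => /andP[xy _] fy.
have : y <= sup Z by apply: ub_le_sup => //; exists T.
move=> yz; have xz : x = sup Z by lra.
by move: fx; rewrite xz Zs ltxx.
Qed.

(** The normalization at the last zero prevents the transition from escaping to
    infinity. *)
Lemma almost_minimizer M e : (m_ W k = M%:E)%E -> 0 < e ->
  exists f g h, [/\ H2 f g h, eventually_pm1 f, f 0 = 0,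
    forall x, 0 <= x -> 0 <= f x &
    forall a b, a <= b -> E f g h a b <= M + e].
Proof.
move=> mM e0.
have mfin : ereal_inf (energies W k eventually_pm1) \is a fin_num.
  by rewrite -/(m_ W k) mM.
have [_ [f [f1 [f2 [Hf Af ->]]]]] := lb_ereal_inf_adherent e0 mfin.
rewrite -/(m_ W k) mM; have [g F ->] := W22loc_normal_form k dw Hf.
rewrite -EFinD => Ee.
have [T T0 [fR fL]] := Af.
have TT : - (T + 1) <= T + 1 by lra.
have cf' : {within `[- (T + 1), T + 1], continuous f}.
  by apply: continuous_subspaceT; exact: H2_cont F.
have f0 : Num.min (f (- (T + 1))) (f (T + 1)) <= 0 <=
    Num.max (f (- (T + 1))) (f (T + 1)).
  by rewrite (fL (- (T + 1))) ?(fR (T + 1)) ?ge_min ?le_max; lra.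
have [x0 _ fx0] := IVT TT cf' f0.
have [|z fz zf] := last_zero (H2_cont F) fR; first by exists x0.
exists (fun x => f (x + z)), (fun x => g (x + z)), (fun x => f2 (x + z)).
split.
- exact: H2_shift.
- exists (T + `|z|); first by have := normr_ge0 z; lra.
  have := ler_norm z; have := ler_norm (- z); rewrite normrN => z1 z2.
  by split => x xT; [apply: fR|apply: fL]; lra.
- by rewrite add0r.
- by move=> x x0'; apply: zf; lra.
- move=> a b ab; rewrite E_shift//.
  have abz : a + z <= b + z by lra.
  by rewrite -lee_fin; apply: le_trans (energy_ge dw k0_gt0 NI k0k F abz) (ltW Ee).
Qed.

Lemma density_bound C f g h : H2 f g h ->
  (forall a b, a <= b -> E f g h a b <= C) ->
  forall a b, a <= b -> Int a b (density f h) <= C / kappa.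
Proof.
move=> F FC a b ab; have kp := kappa_gt0 k0_gt0 k0k.
pose n := (Num.truncn (b - a)).+1.
have bn : b <= a + n%:R.
  by have := truncnS_gt (b - a); rewrite -/n; lra.
have an : a <= a + n%:R by rewrite lerDl.
apply: (@le_trans _ _ (Int a (a + n%:R) (density f h))).
  apply: le_Int_itv => //; first exact: locint_density F.
  by move=> x; exact: density_ge0.
rewrite ler_pdivlMr// mulrC.
by apply: le_trans (E_ge_density dw k0_gt0 NI k0k _ _ F) (FC _ _ an).
Qed.

Lemma Int_sqr2_le_density f g h a b : H2 f g h ->
  Int a b (fun x => h x ^+ 2) <= Int a b (density f h).
Proof.
move=> F; apply: le_Int; first by case: (H2_L2 F).
  exact: locint_density F.
by move=> x _; rewrite lerDr W_ge0.
Qed.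

Lemma sqr_dist_derivative C f g h : H2 f g h ->
  (forall a b, a <= b -> Int a b (density f h) <= C) ->
  forall x y, (g y - g x) ^+ 2 <= `|y - x| * C.
Proof.
move=> F FC x y; pose a := Num.min x y; pose b := Num.max x y.
have ab : a <= b by rewrite /a /b ge_min le_max lexx.
have h1 : a <= x <= b by rewrite /a /b ge_min le_max lexx.
have h2 : a <= y <= b by rewrite /a /b ge_min le_max lexx !orbT.
apply: le_trans (sqr_dist_Int (H2_L2 F) _ h1 h2) _.
  by move=> s t; exact: H2_incr1 F.
rewrite ler_wpM2l//; apply: le_trans (FC _ _ ab).
exact: Int_sqr2_le_density F.
Qed.

(** (N) bounds the mean of g^2 on [x, x + 1], and g varies by at most sqrt C
    there. *)
Lemma sqr_derivative_bound C f g h : H2 f g h ->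
  (forall a b, a <= b -> Int a b (density f h) <= C) ->
  forall x, g x ^+ 2 <= 2 * (C / k0) + 2 * C.
Proof.
move=> F FC x; have x1 : x <= x + 1 by rewrite lerDl.
have lg := locint_sqr1 F.
have C0 : 0 <= C.
  by apply: le_trans (FC _ _ x1); apply: Int_ge0 => y _; exact: density_ge0.
have G1 : Int x (x + 1) (fun y => g y ^+ 2) <= C / k0.
  rewrite ler_pdivlMr// mulrC.
  by apply: le_trans (interpolation_unit dw NI x F) (FC _ _ x1).
have : g x ^+ 2 * (x + 1 - x) <= Int x (x + 1) (fun y => 2 * g y ^+ 2 + 2 * C).
  apply: Int_ge_cst => //.
    by apply: locintD; [exact: locintZ|exact: locint_cst].
  move=> y /andP[xy yx]; have H := sqr_dist_derivative F FC y x.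
  have {}H : (g x - g y) ^+ 2 <= C.
    by apply: le_trans H _; rewrite ler_piMl// ler_norml; lra.
  have := sqr_ge0 (g x - 2 * g y); nra.
rewrite IntD; [|exact: locintZ|exact: locint_cst].
rewrite IntZ// Int_cst//; lra.
Qed.

Lemma lipschitz_of_derivative B f g h : H2 f g h -> (forall x, `|g x| <= B) ->
  forall x y, `|f y - f x| <= B * `|y - x|.
Proof.
move=> F gB; have lg := locint_cont (H2_cont1 F).
have H x y : x <= y -> `|f y - f x| <= B * `|y - x|.
  move=> xy; rewrite (H2_incr F xy) (ger0_norm (_ : 0 <= y - x)) ?subr_ge0//.
  apply: le_trans (le_norm_Int _ _ lg) _; apply: Int_le_cst => //.
  exact: locint_norm.
move=> x y; have [/H//|/ltW yx] := leP x y.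
by rewrite distrC (distrC y); exact: H.
Qed.

End MinimizingSequence.

Section Heine.
Context {R : realType}.

(** The point t may leave [-L, L], whence the covering argument instead of uniform
    continuity on the compact set. *)
Lemma unif_continuous_itv (F : R -> R) (L w : R) : continuous F -> 0 < w ->
  exists2 d, 0 < d &
  forall s t, `|s| <= L -> `|t - s| <= d -> `|F t - F s| <= w.
Proof.
move=> cF w0; have w2 : 0 < w / 2 by rewrite divr_gt0.
pose P (d s : R) := forall t, `|t - s| <= d -> `|F t - F s| <= w.
have H : \forall d \near (0 : R)^'+, `[- L, L]%classic `<=` P d.
  have /compact_near_coveringP := @segment_compact R (- L) L.
  apply=> s _; have /cvgrPdist_lt/(_ _ w2)/nbhs_ballP[r r0 Hr] := cF s.
  have r2 : 0 < r / 2 by rewrite divr_gt0.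
  have near2 : \forall x \near s, `|s - x| < r / 2.
    exact: (@cvgr_dist_lt _ _ _ _ _ id s cvg_id _ r2).
  near=> x d => t /= tx.
  have sx : `|s - x| < r / 2 by near: x.
  have dr : d < r / 2 by near: d; exact: nbhs_right_lt.
  have r_gt0 : 0 < r by exact: r0.
  have h1 : `|F s - F x| < w / 2 by apply: Hr; rewrite /ball/=; lra.
  have h2 : `|F s - F t| < w / 2.
    apply: Hr; rewrite /ball/=; move: tx sx.
    by rewrite ler_norml !ltr_norml; lra.
  by move: h1 h2; rewrite !ltr_norml ler_norml; lra.
near (0 : R)^'+ => d.
have dP : `[- L, L]%classic `<=` P d by near: d.
exists d => [//|s t sL]; apply: dP.
by rewrite /= in_itv/= -ler_norml.
Unshelve. all: by end_near. Qed.

End Heine.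

Section Compactness.
Context {R : realType} (W : R -> R) (k0 k : R).
Hypotheses (dw : double_well W) (k0_gt0 : 0 < k0)
  (NI : interpolation_ineq W k0) (k0k : 0 < k < k0).
Implicit Types (a b c s t x : R) (f g h u v w : R -> R).
Local Notation mu := (@lebesgue_measure R).
Local Notation E := (energy_on W k).
Local Notation lag := (lagrangian W k).
Local Notation density := (density W).
Local Notation kappa := (1 - k / k0).

(** phi = (f + u) / 2 + c agrees to first order with f at the end points of
    [-T, T], and psi = (f + u) / 2 - c with u, where c is the small cubic with the
    boundary data of (f - u) / 2.  By almost minimality
      E f + E u <= E phi + E psi + 2 eta,
    while the parallelogram identity gives
      phi''^2 + psi''^2 = f''^2 + u''^2 - (f'' - u'')^2 / 2 + 2 c''^2,
    and the terms of lower order differ little. *)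
Lemma near_minimal_close M (T L e : R) : (m_ W k = M%:E)%E -> 1 <= T -> 0 < e ->
  exists2 eta, 0 < eta & forall f g h u v w,
  H2 f g h -> eventually_pm1 f -> (forall a b, a <= b -> E f g h a b <= M + eta) ->
  H2 u v w -> eventually_pm1 u -> (forall a b, a <= b -> E u v w a b <= M + eta) ->
  (forall x, `|x| <= T -> `|f x| <= L /\ `|u x| <= L) ->
  (forall x, `|x| <= T -> `|f x - u x| <= eta /\ `|g x - v x| <= eta) ->
  Int (- T) T (fun x => (h x - w x) ^+ 2) <= e.
Proof.
move=> mM T1 e0; have k_gt0 : 0 < k by case/andP: k0k.
have cW : continuous W by case: dw.
have om0 : 0 < e / (32 * T) by rewrite divr_gt0//; lra.
have [d d0 Hd] := @unif_continuous_itv R W L _ cW om0.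
pose K := 20 * T + 1.
(* eta makes |phi - f| <= K eta <= d, and the quadratic errors small *)
pose eta := Num.min (Num.min (d / K) 1) (e / (32 * (T * (k + K ^+ 2) + 1))).
have K0 : 0 < K by rewrite /K; lra.
have D0 : 0 < 32 * (T * (k + K ^+ 2) + 1) by have := sqr_ge0 K; nra.
have eta0 : 0 < eta by rewrite /eta !lt_min ltr01 !divr_gt0.
have [eta_d [eta1 eta_e]] : K * eta <= d /\ eta <= 1 /\
    eta * (32 * (T * (k + K ^+ 2) + 1)) <= e.
  split.
    rewrite mulrC -ler_pdivlMr// /eta.
    by rewrite !ge_min lexx.
  by split; [rewrite /eta !ge_min lexx !orbT
    |rewrite -ler_pdivlMr// /eta ge_min lexx orbT].
exists eta => // f g h u v w F Af Ef U Au Eu fuL fu.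
have nT : `|T| <= T by rewrite ger0_norm//; lra.
have nNT : `|- T| <= T by rewrite normrN.
have half (p : R) : `|p| <= eta -> `|p / 2| <= eta.
  by rewrite !ler_norml; lra.
have TT : - T <= T by lra.
have [cl1 cl2] := fu _ nNT; have [cr1 cr2] := fu _ nT.
have [c [c1 [c2 [C [cl cr] [c1l c1r] cb]]]] :=
  hermite 0 T1 (half _ cl1) (half _ cr1) (half _ cl2) (half _ cr2).
rewrite sub0r add0r in cl cr c1l c1r cb.
pose phi x := 2^-1 * (f x + u x) + c x.
pose phi1 x := 2^-1 * (g x + v x) + c1 x.
pose phi2 x := 2^-1 * (h x + w x) + c2 x.
pose psi x := 2^-1 * (f x + u x) + -1 * c x.
pose psi1 x := 2^-1 * (g x + v x) + -1 * c1 x.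
pose psi2 x := 2^-1 * (h x + w x) + -1 * c2 x.
have Phi : H2 phi phi1 phi2 by exact: H2D (H2Z 2^-1 (H2D F U)) C.
have Psi : H2 psi psi1 psi2 by exact: H2D (H2Z 2^-1 (H2D F U)) (H2Z (-1) C).
set e1 := E phi phi1 phi2 (- T) T; set e2 := E psi psi1 psi2 (- T) T.
have HPhi : E f g h (- T) T <= e1 + eta.
  by apply: (E_near_minimal dw k0_gt0 NI k0k mM F Af Ef Phi TT);
    rewrite /phi /phi1 ?cl ?cr ?c1l ?c1r; field.
have HPsi : E u v w (- T) T <= e2 + eta.
  by apply: (E_near_minimal dw k0_gt0 NI k0k mM U Au Eu Psi TT);
    rewrite /psi /psi1 ?cl ?cr ?c1l ?c1r; field.
pose err := 2 * (e / (32 * T)) + k * (eta ^+ 2 / 2) + 2 * (K * eta) ^+ 2.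
have lL f' g' h' : H2 f' g' h' -> locint (lag f' g' h').
  exact: locint_lagrangian.
have lhw : locint (fun x => (h x - w x) ^+ 2).
  by case: (L2locB (H2_L2 F) (H2_L2 U)).
have lS : locint (fun x => lag f g h x + lag u v w x).
  by apply: locintD; apply: lL.
have lR : locint (fun x => 2^-1 * (h x - w x) ^+ 2) by exact: locintZ.
have lQ : locint (fun x => lag f g h x + lag u v w x -
      2^-1 * (h x - w x) ^+ 2) by exact: locintB.
have le12 : e1 + e2 <= E f g h (- T) T + E u v w (- T) T -
    2^-1 * Int (- T) T (fun x => (h x - w x) ^+ 2) + err * (T - - T).
  rewrite -Int_cst// -IntZ// -IntD; [|exact: lL..].
  rewrite -IntD; [|exact: lL..].
  rewrite -IntB// -IntD//; last exact: locint_cst.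
  apply: le_Int.
  - by apply: locintD; apply: lL.
  - by apply: locintD => //; exact: locint_cst.
  move=> x xT; have xT' : `|x| <= T by rewrite ler_norml.
  have [cx c1x c2x] := cb x xT; have [fux gvx] := fu x xT'.
  have [fL uL] := fuL x xT'.
  have Wphi : W (phi x) <= W (f x) + e / (32 * T).
    have : `|W (phi x) - W (f x)| <= e / (32 * T).
      apply: Hd => //; apply: le_trans eta_d.
      have -> : phi x - f x = c x - (f x - u x) / 2 by rewrite /phi; field.
      by move: cx fux; rewrite /K !ler_norml; clear -dw k0_gt0 NI k0k T1 eta0; lra.
    by rewrite ler_norml; clear -dw k0_gt0 NI k0k; lra.
  have Wpsi : W (psi x) <= W (u x) + e / (32 * T).
    have : `|W (psi x) - W (u x)| <= e / (32 * T).
      apply: Hd => //; apply: le_trans eta_d.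
      have -> : psi x - u x = - c x + (f x - u x) / 2 by rewrite /psi; field.
      by move: cx fux; rewrite /K !ler_norml; clear -dw k0_gt0 NI k0k T1 eta0; lra.
    by rewrite ler_norml; clear -dw k0_gt0 NI k0k; lra.
  have Q1 : (g x - v x) ^+ 2 <= eta ^+ 2.
    by rewrite -real_normK ?num_real// ler_sqr ?nnegrE// ltW.
  have Q2 : c2 x ^+ 2 <= (K * eta) ^+ 2.
    rewrite -real_normK ?num_real// ler_sqr ?nnegrE//.
      by apply: le_trans c2x _; rewrite ler_pM2r// /K; clear -dw k0_gt0 NI k0k; lra.
    by rewrite mulr_ge0// ltW.
  have E1 : g x ^+ 2 + v x ^+ 2 - phi1 x ^+ 2 - psi1 x ^+ 2 =
      (g x - v x) ^+ 2 / 2 - 2 * c1 x ^+ 2 by rewrite /phi1 /psi1; field.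
  have E2 : phi2 x ^+ 2 + psi2 x ^+ 2 =
      h x ^+ 2 + w x ^+ 2 - 2^-1 * (h x - w x) ^+ 2 + 2 * c2 x ^+ 2.
    by rewrite /phi2 /psi2; field.
  have E3 : k * (g x ^+ 2 + v x ^+ 2 - phi1 x ^+ 2 - psi1 x ^+ 2) <=
      k * (eta ^+ 2 / 2).
    by rewrite E1 ler_pM2l//; move: (sqr_ge0 (c1 x)) Q1; clear -dw k0_gt0 NI k0k; lra.
  by move: Wphi Wpsi E2 E3 Q2; rewrite /lagrangian /err; clear -dw k0_gt0 NI k0k; lra.
have errE : 2 * (err * (T - - T)) <= e / 4 + e / 4.
  have -> : 2 * (err * (T - - T)) =
      e / 4 + (2 * T * k * eta ^+ 2 + 8 * T * K ^+ 2 * eta ^+ 2).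
    by rewrite /err; field; rewrite gt_eqF// (lt_le_trans ltr01).
  rewrite lerD2l.
  have q : eta ^+ 2 <= eta by rewrite expr2 ler_piMl// ltW.
  have T0 : 0 < T by exact: lt_le_trans T1.
  have X0 : 0 < T * k by rewrite mulr_gt0.
  have Y0 : 0 < T * K ^+ 2 by rewrite mulr_gt0 ?exprn_gt0.
  have HX : T * k * eta ^+ 2 <= T * k * eta by rewrite ler_pM2l.
  have HY : T * K ^+ 2 * eta ^+ 2 <= T * K ^+ 2 * eta by rewrite ler_pM2l.
  have X1 : 0 <= T * k * eta by rewrite mulr_ge0 ?ltW.
  by move: eta_e HX HY X1; rewrite mulrDr mulrDr; lra.
have eta8 : 4 * eta <= e / 4.
  have T0 : 0 < T by exact: lt_le_trans T1.
  have : 0 < T * (k + K ^+ 2) by rewrite mulr_gt0// addr_gt0// exprn_gt0.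
  by move: eta_e eta0; clear -dw k0_gt0 NI k0k; nra.
by move: e0 le12 errE eta8 HPhi HPsi; clear -dw k0_gt0 NI k0k; lra.
Qed.

End Compactness.

Section MinimizingSubsequence.
Context {R : realType} (W : R -> R) (k0 k : R).
Hypotheses (dw : double_well W) (k0_gt0 : 0 < k0)
  (NI : interpolation_ineq W k0) (k0k : 0 < k < k0).
Implicit Types (a b s t x e : R).
Local Notation E := (energy_on W k).
Local Notation kappa := (1 - k / k0).

Definition approx_minimizer M (j : nat) f g h := [/\ H2 f g h, eventually_pm1 f,
  f 0 = 0, forall x, 0 <= x -> 0 <= f x &
  forall a b, a <= b -> E f g h a b <= M + j.+1%:R^-1].

Lemma invS_le1 (j : nat) : j.+1%:R^-1 <= 1 :> R.
Proof. by rewrite invf_le1// ler1n. Qed.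

Lemma le_invS (i j : nat) : (i <= j)%N -> j.+1%:R^-1 <= i.+1%:R^-1 :> R.
Proof. by move=> ij; rewrite lef_pV2 ?posrE// ler_nat. Qed.

Lemma small_invS e (N : nat) : 0 < e ->
  exists J, forall j, (J <= j)%N -> (N <= j)%N /\ j.+1%:R^-1 <= e.
Proof.
move=> e0; exists (Num.truncn e^-1 + N)%N => j Jj; split.
  by apply: leq_trans Jj; exact: leq_addl.
rewrite -[leRHS]invrK lef_pV2 ?posrE ?invr_gt0//.
apply: le_trans (ltW (truncnS_gt _)) _; rewrite ler_nat ltnS.
by apply: leq_trans Jj; exact: leq_addr.
Qed.

Lemma minimizing_sequence M : (m_ W k = M%:E)%E -> exists (C B : R) (f g h : nat -> R -> R)
    (v v' : R -> R), [/\
  forall j, approx_minimizer M j (f j) (g j) (h j),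
  forall j a b, a <= b -> Int a b (density W (f j) (h j)) <= C,
  forall j x, `|g j x| <= B &
  forall (j : nat) x, `|x| <= j%:R -> `|f j x - v x| <= j.+1%:R^-1 /\
                              `|g j x - v' x| <= j.+1%:R^-1].
Proof.
move=> mM.
have ex j : exists p : (R -> R) * (R -> R) * (R -> R),
    approx_minimizer M j p.1.1 p.1.2 p.2.
  have j0 : 0 < j.+1%:R^-1 :> R by rewrite invr_gt0.
  have [f [g [h [? ? ? ? ?]]]] := almost_minimizer dw k0_gt0 NI k0k mM j0.
  by exists (f, g, h).
have /choice[F HF] := ex.
pose C := (M + 1) / kappa.
have HC j a b : a <= b -> Int a b (density W (F j).1.1 (F j).2) <= C.
  have [HH _ _ _ HE] := HF j; apply: (density_bound dw k0_gt0 NI k0k HH).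
  move=> a' b' ab'; apply: le_trans (HE _ _ ab') _.
  by rewrite lerD2l invS_le1.
have C0 : 0 <= C.
  apply: le_trans (HC 0%N 0 0 (lexx _)); apply: Int_ge0 => x _.
  exact: density_ge0.
pose B := 2 * (C / k0) + 2 * C + 1.
have Ck0 : 0 <= C / k0 by rewrite divr_ge0// ltW.
have B1 : 1 <= B by rewrite /B; lra.
have HB j x : `|(F j).1.2 x| <= B.
  have [HH _ _ _ _] := HF j.
  have := sqr_derivative_bound dw k0_gt0 NI HH (HC j) x.
  rewrite -real_normK ?num_real//; set G := `|_| => HG.
  have G0 : 0 <= G by exact: normr_ge0.
  rewrite leNgt; apply/negP => BG; move: HG BG B1; rewrite /B; nra.
have Lip j x y : `|(F j).1.1 x - (F j).1.1 y| <= B * `|x - y|.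
  by have [HH _ _ _ _] := HF j; apply: (lipschitz_of_derivative HH).
have equ : equicontinuous_seq (fun j => (F j).1.1).
  move=> e e0; exists (e / B); first by rewrite divr_gt0//; lra.
  move=> n x y xy; apply: le_trans (Lip n x y) _.
  by rewrite mulrC -ler_pdivlMr//; lra.
have equ' : equicontinuous_seq (fun j => (F j).1.2).
  move=> e e0; have C1 : 0 < C + 1 by lra.
  exists (e ^+ 2 / (C + 1)); first by rewrite divr_gt0// exprn_gt0.
  move=> n x y xy; have [HH _ _ _ _] := HF n.
  have H := sqr_dist_derivative dw HH (HC n) y x.
  rewrite ler_pdivlMr// in xy.
  rewrite -ler_sqr ?nnegrE ?(ltW e0)// real_normK ?num_real//.
  by apply: le_trans H _; apply: le_trans xy; rewrite ler_wpM2l//; lra.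
have bf n x : `|(F n).1.1 x| <= B * `|x| + B.
  have [_ _ f0 _ _] := HF n; have := Lip n x 0.
  rewrite f0 !subr0 => /le_trans; apply; lra.
have bg n x : `|(F n).1.2 x| <= B * `|x| + B.
  apply: le_trans (HB n x) _; rewrite lerDr mulr_ge0//; lra.
have [sigma [v [v' Hs]]] := Arzela_Ascoli equ equ' bf bg.
exists C, B, (fun j => (F (sigma j)).1.1), (fun j => (F (sigma j)).1.2),
  (fun j => (F (sigma j)).2), v, v'; split => //.
- move=> j; have [sj _] := Hs j; have [? ? ? ? HE] := HF (sigma j).
  split => // a b ab; apply: le_trans (HE _ _ ab) _.
  by rewrite lerD2l le_invS.
- by move=> j a b; exact: HC.
- by move=> j x xj; have [_ Hj] := Hs j; exact: Hj.
Qed.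

End MinimizingSubsequence.

Section Limit.
Context {R : realType} (W : R -> R) (k0 k : R).
Hypotheses (dw : double_well W) (k0_gt0 : 0 < k0)
  (NI : interpolation_ineq W k0) (k0k : 0 < k < k0).
Implicit Types (a b s t x e : R).
Local Notation E := (energy_on W k).
Variables (M C B : R) (f g h : nat -> R -> R) (v v' : R -> R).
Hypotheses (mM : (m_ W k = M%:E)%E)
  (Happ : forall j, approx_minimizer W k M j (f j) (g j) (h j))
  (HC : forall j a b, a <= b -> Int a b (density W (f j) (h j)) <= C)
  (HB : forall j x, `|g j x| <= B)
  (Hcv : forall (j : nat) x, `|x| <= j%:R -> `|f j x - v x| <= j.+1%:R^-1 /\
                              `|g j x - v' x| <= j.+1%:R^-1).

Let HH j : H2 (f j) (g j) (h j). Proof. by case: (Happ j). Qed.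

Let B_ge0 : 0 <= B. Proof. exact: le_trans (normr_ge0 _) (HB 0 0). Qed.

Let C_ge0 : 0 <= C.
Proof.
apply: le_trans (HC 0 (lexx 0)); apply: Int_ge0 => x _; exact: density_ge0.
Qed.

Lemma f_bound j x : `|f j x| <= B * `|x|.
Proof.
have [_ _ f0 _ _] := Happ j.
by have := lipschitz_of_derivative (HH j) (HB j) 0 x; rewrite f0 !subr0.
Qed.

Lemma L2_cauchy (T : nat) e : 0 < e -> exists J, forall i j, (J <= i)%N ->
  (J <= j)%N -> Int (- T%:R) T%:R (fun x => (h i x - h j x) ^+ 2) <= e.
Proof.
move=> e0; have T1 : 1 <= T.+1%:R :> R by rewrite ler1n.
have [eta eta0 Heta] :=
  near_minimal_close dw k0_gt0 NI k0k (B * T.+1%:R) mM T1 e0.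
have eta2 : 0 < eta / 2 by rewrite divr_gt0.
have [J HJ] := small_invS T.+1 eta2; exists J => i j Ji Jj.
have [iT ie] := HJ i Ji; have [jT je] := HJ j Jj.
apply: (@le_trans _ _ (Int (- T.+1%:R) T.+1%:R (fun x => (h i x - h j x) ^+ 2))).
  have TT : T%:R <= T.+1%:R :> R by rewrite ler_nat.
  have T0 := ler0n R T.
  apply: le_Int_itv; [|by move=> x; exact: sqr_ge0|lra|lra|lra].
  by case: (L2locB (H2_L2 (HH i)) (H2_L2 (HH j))).
have [? ? _ _ Ei] := Happ i; have [? ? _ _ Ej] := Happ j.
have half : eta / 2 <= eta by lra.
apply: (Heta (f i) (g i) _ (f j) (g j)) => //.
- by move=> a b ab; apply: le_trans (Ei _ _ ab) _; rewrite lerD2l (le_trans ie).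
- by move=> a b ab; apply: le_trans (Ej _ _ ab) _; rewrite lerD2l (le_trans je).
- by move=> x xT; split; apply: le_trans (f_bound _ _) _; rewrite ler_wpM2l.
- move=> x xT.
  have xi : `|x| <= i%:R by apply: le_trans xT _; rewrite ler_nat.
  have xj : `|x| <= j%:R by apply: le_trans xT _; rewrite ler_nat.
  have [f1 g1] := Hcv xi; have [f2 g2] := Hcv xj.
  have {f1} f1 := le_trans f1 ie; have {f2} f2 := le_trans f2 je.
  have {g1} g1 := le_trans g1 ie; have {g2} g2 := le_trans g2 je.
  by split; [move: f1 f2|move: g1 g2]; rewrite !ler_norml; lra.
Qed.

Lemma eq0_of_sqr_le (X K : R) : 0 <= K ->
  (forall e, 0 < e -> e <= 1 -> X ^+ 2 <= e * K) -> X = 0.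
Proof.
move=> K0 H; apply/eqP; rewrite -sqrf_eq0 eq_le sqr_ge0 andbT leNgt.
apply/negP => X0; pose e := Num.min 1 (X ^+ 2 / (2 * (K + 1))).
have e0 : 0 < e by rewrite /e lt_min ltr01 divr_gt0//; lra.
have e1 : e <= 1 by rewrite /e ge_min lexx.
have := H e e0 e1; have : e <= X ^+ 2 / (2 * (K + 1)) by rewrite /e ge_min lexx orbT.
rewrite ler_pdivlMr; last by lra.
move: X0 e0; set Y := X ^+ 2; lra.
Qed.

Lemma limit_H2 l : L2loc l ->
  (forall (T : nat) e, 0 < e -> exists J, forall j, (J <= j)%N ->
     Int (- T%:R) T%:R (fun x => (h j x - l x) ^+ 2) <= e) -> H2 v v' l.
Proof.
move=> ll Hl.
have box s t : exists T : nat, `|s| <= T%:R /\ `|t| <= T%:R.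
  exists (Num.truncn (`|s| + `|t|)).+1; have := truncnS_gt (`|s| + `|t|).
  by have := normr_ge0 s; have := normr_ge0 t; lra.
have incr1 s t : s <= t -> v' t - v' s = Int s t l.
  move=> st; have [T [sT tT]] := box s t.
  apply/eqP; rewrite -subr_eq0; apply/eqP.
  apply: (@eq0_of_sqr_le _ (8 + 2 * (t - s))); first by lra.
  move=> e e0 e1; have [J1 HJ1] := Hl T e e0; have [J2 HJ2] := small_invS T e0.
  pose j := maxn J1 J2.
  have {HJ1} HJ1 := HJ1 j (leq_maxl _ _).
  have {HJ2} [Tj je] := HJ2 j (leq_maxr _ _).
  have sj : `|s| <= j%:R by apply: le_trans sT _; rewrite ler_nat.
  have tj : `|t| <= j%:R by apply: le_trans tT _; rewrite ler_nat.
  have [_ /le_trans/(_ je) gs] := Hcv sj; have [_ /le_trans/(_ je) gt] := Hcv tj.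
  have lhl := L2locB (H2_L2 (HH j)) ll.
  have CS : (Int s t (fun x => h j x - l x)) ^+ 2 <= (t - s) * e.
    have aT : - T%:R <= s by move: sT; rewrite ler_norml => /andP[].
    have bT : t <= T%:R by move: tT; rewrite ler_norml => /andP[].
    apply: le_trans (sqr_Int_le lhl aT st bT) _.
    by rewrite ler_wpM2l// subr_ge0.
  move: CS; rewrite IntB; [|exact: L2loc_locint (H2_L2 (HH j))|exact: L2loc_locint].
  rewrite -(H2_incr1 (HH j) st); set b := _ - _ - Int s t l => CS.
  set X := _ - _ - Int s t l.
  have : `|X - b| <= 2 * e.
    by rewrite /X /b; move: gs gt; rewrite !ler_norml; lra.
  rewrite ler_norml => /andP[h1 h2].
  have : (X - b) ^+ 2 <= 4 * e by nra.
  have := sqr_ge0 (X - 2 * b); nra.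
have cv' := cont_increment ll incr1; have lv' := locint_cont cv'.
apply: H2_of_increments => // s t st; have [T [sT tT]] := box s t.
apply/eqP; rewrite -subr_eq0; apply/eqP.
apply: (@eq0_of_sqr_le _ ((2 + (t - s)) ^+ 2)); first exact: sqr_ge0.
move=> e e0 e1; have [J HJ] := small_invS T e0; have [Tj je] := HJ J (leqnn J).
have TJ : T%:R <= J%:R :> R by rewrite ler_nat.
have [/le_trans/(_ je) fs _] := Hcv (le_trans sT TJ).
have [/le_trans/(_ je) ft _] := Hcv (le_trans tT TJ).
have lg := locint_cont (H2_cont1 (HH J)).
have lgv : locint (fun x => g J x - v' x) by exact: locintB.
have : `|Int s t (fun x => g J x - v' x)| <= e * (t - s).
  apply: le_trans (le_norm_Int _ _ lgv) _; apply: Int_le_cst => //.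
    exact: locint_norm.
  move=> x /andP[sx xt]; apply: le_trans je.
  have xJ : `|x| <= J%:R.
    by move: sT tT; rewrite !ler_norml; lra.
  by have [_] := Hcv xJ.
rewrite IntB// -(H2_incr (HH J) st) => H.
have : `|v t - v s - Int s t v'| <= e * (2 + (t - s)).
  by move: H fs ft; rewrite !ler_norml; lra.
rewrite -ler_sqr ?nnegrE//; last by rewrite mulr_ge0//; lra.
rewrite real_normK ?num_real// => /le_trans; apply.
by rewrite exprMn ler_wpM2r ?sqr_ge0// expr2 ler_piMl// ltW.
Qed.

(** W(f j) and (g j)^2 converge uniformly on [-N, N] and (h j)^2 in L^1, so that the
    energies on [-N, N] converge. *)
Lemma limit_E l : L2loc l -> H2 v v' l ->
  (forall (T : nat) e, 0 < e -> exists J, forall j, (J <= j)%N ->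
     Int (- T%:R) T%:R (fun x => (h j x - l x) ^+ 2) <= e) ->
  forall N : nat, E v v' l (- N%:R) N%:R <= M.
Proof.
move=> ll HV Hl N; have k_gt0 : 0 < k by case/andP: k0k.
have N0 := ler0n R N; have NN : - N%:R <= N%:R :> R by lra.
pose K := 2 * N%:R * (1 + k * (2 * B + 1)) + C + 3.
have K0 : 0 < K.
  rewrite /K; have := B_ge0; have := C_ge0 => C0 B0.
  have : 0 <= N%:R * (1 + k * (2 * B + 1)).
    by rewrite mulr_ge0// addr_ge0// mulr_ge0 ?(ltW k_gt0)//; lra.
  lra.
suff main e : 0 < e -> e <= 1 -> E v v' l (- N%:R) N%:R <= M + e * K.
  apply/ler_addgt0Pr => e e0.
  have e0' : 0 < Num.min 1 (e / K) by rewrite lt_min ltr01 divr_gt0.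
  have := main _ e0' _; rewrite ge_min lexx => /(_ isT) /le_trans; apply.
  by rewrite lerD2l -ler_pdivlMr// ge_min lexx orbT.
move=> e0 e1; have cW : continuous W by case: dw.
have [d d0 Hd] := @unif_continuous_itv R W (B * N%:R) _ cW e0.
have de0 : 0 < Num.min d e by rewrite lt_min d0.
have [J1 HJ1] := small_invS N de0; have [J2 HJ2] := Hl N (e ^+ 2) (exprn_gt0 _ e0).
pose j := maxn J1 J2.
have {HJ1} [Nj] := HJ1 j (leq_maxl _ _).
have {HJ2} HJ2 := HJ2 j (leq_maxr _ _).
rewrite le_min => /andP[jd je].
have lh := H2_L2 (HH j); have [_ lh2] := lh; have [_ ll2] := ll.
have llh := L2locB ll lh.
have lL := locint_lagrangian k dw (HH j).
have Il2 : Int (- N%:R) N%:R (fun x => l x ^+ 2) <=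
    Int (- N%:R) N%:R (fun x => h j x ^+ 2) + e * (C + 2).
  have := Int_sqrD_le NN e0 lh llh.
  rewrite (@eq_Int _ _ _ (fun x => (h j x + (l x - h j x)) ^+ 2) (fun x => l x ^+ 2)).
    rewrite (@eq_Int _ _ _ (fun x => (l x - h j x) ^+ 2)
      (fun x => (h j x - l x) ^+ 2)).
      have Ch : Int (- N%:R) N%:R (fun x => h j x ^+ 2) <= C.
        by apply: le_trans (HC j NN); apply: (Int_sqr2_le_density dw _ _ (HH j)).
      move: HJ2 Ch; set S := Int _ _ _; set H := Int _ _ _ => HS HHC I.
      have : (1 + e^-1) * S <= (1 + e^-1) * e ^+ 2.
        by rewrite ler_wpM2l// addr_ge0// invr_ge0 ltW.
      have -> : (1 + e^-1) * e ^+ 2 = e ^+ 2 + e by field; rewrite gt_eqF.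
      have : e ^+ 2 <= e by rewrite expr2 ler_piMl// ltW.
      nra.
    by move=> x _; rewrite -sqrrN opprB.
  by move=> x _; rewrite addrC subrK.
pose V x := W (v x) - k * v' x ^+ 2.
pose P x := W (f j x) - k * g j x ^+ 2.
have lV : locint V.
  by apply: locintB; [exact: (locint_W dw (H2_cont HV))|exact/locintZ/(locint_sqr1 HV)].
have lP : locint P.
  apply: locintB; first exact: (locint_W dw (H2_cont (HH j))).
  exact/locintZ/(locint_sqr1 (HH j)).
have VP : Int (- N%:R) N%:R V <=
    Int (- N%:R) N%:R P + e * (1 + k * (2 * B + 1)) * (N%:R - - N%:R).
  rewrite -Int_cst// -IntD//; last exact: locint_cst.
  apply: le_Int => //; first by apply: locintD => //; exact: locint_cst.
  move=> x xN; have xN' : `|x| <= N%:R by rewrite ler_norml.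
  have NjR : N%:R <= j%:R :> R by rewrite ler_nat.
  have [fv gv] := Hcv (le_trans xN' NjR).
  have Wfv : `|W (v x) - W (f j x)| <= e.
    apply: Hd.
      by apply: le_trans (f_bound _ _) _; rewrite ler_wpM2l.
    by rewrite distrC (le_trans fv).
  have gB := HB j x.
  have {}gv : `|g j x - v' x| <= e by apply: le_trans gv je.
  have G : `|g j x ^+ 2 - v' x ^+ 2| <= e * (2 * B + 1).
    rewrite subr_sqr normrM ler_pM//.
    by move: gv gB; rewrite !ler_norml; lra.
  have : k * (g j x ^+ 2 - v' x ^+ 2) <= k * (e * (2 * B + 1)).
    by rewrite ler_pM2l//; apply: le_trans G; exact: ler_norm.
  move: Wfv; rewrite ler_norml /V /P; lra.
have [_ _ _ _ /(_ _ _ NN) HE] := Happ j.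
have {HE} : E (f j) (g j) (h j) (- N%:R) N%:R <= M + e.
  by apply: le_trans HE _; rewrite lerD2l.
have -> : E (f j) (g j) (h j) (- N%:R) N%:R =
   Int (- N%:R) N%:R P + Int (- N%:R) N%:R (fun x => h j x ^+ 2).
  by rewrite -IntD.
have -> : E v v' l (- N%:R) N%:R =
   Int (- N%:R) N%:R V + Int (- N%:R) N%:R (fun x => l x ^+ 2).
  by rewrite -IntD.
rewrite /K; move: VP Il2 {je jd}; lra.
Qed.

End Limit.

(** * Behaviour at infinity and existence of a minimizer *)

Section LimitsAtInfinity.
Context {R : realType} (W : R -> R) (k0 k : R).
Hypotheses (dw : double_well W) (k0_gt0 : 0 < k0)
  (NI : interpolation_ineq W k0) (k0k : 0 < k < k0).
Implicit Types (a b s t x e : R) (f g h : R -> R).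
Local Notation E := (energy_on W k).
Local Notation kappa := (1 - k / k0).

(** As f is Lipschitz, a point where |f| is far from 1 comes with an interval on
    which W(f) has an integral at least q.  No such interval lies far from the
    origin, where the integral of W(f) + h^2 is less than q. *)
Lemma abs_cvg_well f g h B C : H2 f g h -> (forall x, `|g x| <= B) ->
  (forall a b, a <= b -> Int a b (density W f h) <= C) ->
  forall e, 0 < e -> exists X, forall x, X <= `|x| -> `| `|f x| - 1| <= e.
Proof.
move=> F gB FC e e0; have [c c0 Wc] := double_well_quadratic dw.
have B0 : 0 <= B by apply: le_trans (gB 0).
have lD := locint_density dw F.
have D0 x := density_ge0 dw f h x.
pose r := Num.min 1 (e / (2 * (B + 1))).
have r0 : 0 < r by rewrite /r lt_min ltr01 divr_gt0//; lra.
have r1 : r <= 1 by rewrite /r ge_min lexx.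
have Br : B * r <= e / 2.
  have : r <= e / (2 * (B + 1)) by rewrite /r ge_min lexx orbT.
  rewrite ler_pdivlMr; [nra|lra].
pose q := c * (e / 2) ^+ 2 * r.
have q0 : 0 < q by rewrite !mulr_gt0// exprn_gt0 ?divr_gt0.
have bad x : e < `| `|f x| - 1| -> q <= Int x (x + r) (density W f h).
  move=> fx; have xr : x <= x + r by lra.
  rewrite (_ : q = c * (e / 2) ^+ 2 * (x + r - x)); last by rewrite /q; ring.
  apply: Int_ge_cst => // y /andP[xy yr].
  apply: (@le_trans _ _ (W (f y))); last by rewrite lerDl sqr_ge0.
  apply: le_trans (Wc _); rewrite ler_pM2l//.
  have : `|f y - f x| <= e / 2.
    apply: le_trans (lipschitz_of_derivative F gB x y) _.
    by apply: le_trans Br; rewrite ler_wpM2l// ger0_norm; lra.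
  have := ler_dist_dist (f y) (f x) => /le_trans /[apply].
  move: fx; rewrite ltr_normr ler_norml => /orP[] fx /andP[h1 h2]; nra.
pose I n := Int (- n%:R) n%:R (density W f h).
have nn (n : nat) : - n%:R <= n%:R :> R by have := ler0n R n; lra.
have hI : has_sup (range I).
  split; first by exists (I 0%N), 0%N.
  by exists C => _ [n _ <-]; exact: FC.
have [_ [n _ <-] In] := sup_adherent q0 hI.
exists n.+1%:R => x xn; rewrite leNgt; apply/negP => /bad qx.
pose N := (Num.truncn `|x|).+2.
have xN : `|x| + 1 < N%:R.
  by have := truncnS_gt `|x|; rewrite /N -[in X in _ -> X]natr1; lra.
have IN : I N <= sup (range I) by apply: ub_le_sup; [case: hI|exists N].
clearbody N.
suff : I n + Int x (x + r) (density W f h) <= I N by lra.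
have xr : x <= x + r by lra.
move: xn; rewrite -natr1 => xn; have n0 := ler0n R n.
have [x0|x0] := leP 0 x.
  rewrite ger0_norm// in xn xN.
  have b2 : n%:R <= N%:R :> R by lra.
  have b1 : - N%:R <= - n%:R :> R by rewrite lerN2.
  have b3 : x + r <= N%:R by lra.
  rewrite /I (Int_split lD b1 (le_trans (nn n) b2)) (Int_split lD (nn n) b2).
  have : 0 <= Int (- N%:R) (- n%:R) (density W f h) by apply: Int_ge0.
  have : Int x (x + r) (density W f h) <= Int n%:R N%:R (density W f h).
    by apply: le_Int_itv => //; lra.
  lra.
rewrite ltr0_norm// in xn xN.
have b2 : n%:R <= N%:R :> R by lra.
have b1 : - N%:R <= - n%:R :> R by rewrite lerN2.
rewrite /I (Int_split lD b1 (le_trans (nn n) b2)) (Int_split lD (nn n) b2).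
have : 0 <= Int n%:R N%:R (density W f h) by apply: Int_ge0.
have : Int x (x + r) (density W f h) <= Int (- N%:R) (- n%:R) (density W f h).
  by apply: le_Int_itv => //; lra.
lra.
Qed.

Lemma derivative_eventually_pm1 f g h T : H2 f g h ->
  (forall x, x < - T -> f x = -1) -> forall x, x < - T -> g x = 0.
Proof.
move=> [df _ _ _] fT x xT; have [_ <-] := df x.
rewrite (@near_eq_derive _ _ _ _ (cst (-1 : R))) ?oner_eq0 ?derive_cst//.
by near=> y; apply: fT; near: y; exact: lt_nbhsl.
Unshelve. all: by end_near. Qed.

Lemma same_sign f s t : continuous f -> s <= t ->
  (forall x, s <= x <= t -> f x != 0) -> (0 < f s) = (0 < f t).
Proof.
move=> cf st f0; apply/idP/idP => f1; rewrite ltNge; apply/negP => f2.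
- have H : Num.min (f s) (f t) <= 0 <= Num.max (f s) (f t).
    by rewrite ge_min le_max f2 (ltW f1) orbT.
  have [x] := IVT st (continuous_subspaceT cf) H.
  by rewrite in_itv/= => /f0 /eqP.
- have H : Num.min (f s) (f t) <= 0 <= Num.max (f s) (f t).
    by rewrite ge_min le_max f2 (ltW f1) orbT.
  have [x] := IVT st (continuous_subspaceT cf) H.
  by rewrite in_itv/= => /f0 /eqP.
Qed.

Section Sequence.
Variables (M C B : R) (f g h : nat -> R -> R) (v v' l : R -> R).
Hypotheses (mM : (m_ W k = M%:E)%E)
  (Happ : forall j, approx_minimizer W k M j (f j) (g j) (h j))
  (Hcv : forall (j : nat) x, `|x| <= j%:R -> `|f j x - v x| <= j.+1%:R^-1 /\
                              `|g j x - v' x| <= j.+1%:R^-1)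
  (HV : H2 v v' l).

Lemma limit_ge0 x : 0 <= x -> 0 <= v x.
Proof.
move=> x0; apply/ler_addgt0Pr => e e0.
have [J HJ] := small_invS (Num.truncn `|x|).+1 e0.
have [Jx Je] := HJ J (leqnn J).
have xJ : `|x| <= J%:R.
  by apply: le_trans (ltW (truncnS_gt _)) _; rewrite ler_nat.
have [/le_trans/(_ Je) fv _] := Hcv xJ.
have [_ _ _ /(_ _ x0) fx _] := Happ J.
by move: fv; rewrite ler_norml; lra.
Qed.

(** If v were near 1 far to the left, the f j would have made a transition
    there already, while still paying for their zero at 0. *)
(** If v were near 1 far to the left, the f j would have made a transition there
    already, at the cost of almost m_k, while the unit interval to the right of
    their zero at 0 still adds a fixed amount. *)
Lemma not_left_one : ~ (forall e, 0 < e -> exists X, forall x, x <= X ->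
  `|v x - 1| <= e).
Proof.
move=> Hv; have [d1 d10 Hd1] := zero_cost dw k0_gt0 NI.
have kp := kappa_gt0 k0_gt0 k0k.
pose z := kappa * d1; have z0 : 0 < z by rewrite mulr_gt0.
have z3 : 0 < z / 3 by rewrite divr_gt0.
have [d d0 Hd] := m_le_near_wells dw k0_gt0 NI k0k z3.
have d4 : 0 < d / 2 / 2 by rewrite !divr_gt0.
have [X HX] := Hv _ d4.
pose a := Num.min X 0 - 1.
have aX : a + 1 <= X by rewrite /a subrK ge_min lexx.
have a0 : a + 1 <= 0 by rewrite /a subrK ge_min lexx orbT.
have [t [ta vt v't]] : exists x, [/\ a <= x <= a + 1, `|v x - 1| <= d / 2 &
    `|v' x| <= d / 2].
  apply: (flat_point HV) => x /andP[_ xa]; apply: HX; lra.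
have d2z : 0 < Num.min (d / 2) (z / 3) by rewrite lt_min divr_gt0.
have [J HJ] := small_invS (Num.truncn `|t|).+1 d2z.
have [Jt] := HJ J (leqnn J); rewrite le_min => /andP[Jd Jz].
have tJ : `|t| <= J%:R.
  by apply: le_trans (ltW (truncnS_gt _)) _; rewrite ler_nat.
have [/le_trans/(_ Jd) ft /le_trans/(_ Jd) gt] := Hcv tJ.
have [F [T T0 [_ fL]] f0 _ fE] := Happ J.
pose s := - (T + `|t| + 1).
have sT : s < - T by have := normr_ge0 t; rewrite /s; lra.
have st : s <= t by have := ler_norm (- t); rewrite normrN /s; lra.
have t0 : t <= 0 by move: ta => /andP[_]; lra.
have := Hd (f J) (g J) (h J) s t F st.
rewrite (fL s sT) (derivative_eventually_pm1 F fL sT) addNr normr0.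
have ft' : `|f J t - 1| <= d by move: ft vt; rewrite !ler_norml; lra.
have gt' : `|g J t| <= d by move: gt v't; rewrite !ler_norml; lra.
move=> /(_ (ltW d0) (ltW d0) ft' gt'); rewrite mM lee_fin => mE.
pose n := (Num.truncn (1 - t)).+1.
have tn : 1 <= t + n%:R by have := truncnS_gt (1 - t); rewrite -/n; lra.
have ttn : t <= t + n%:R by rewrite lerDl.
have := fE _ _ (le_trans st ttn); rewrite (E_split k dw F st ttn).
have : z <= E (f J) (g J) (h J) t (t + n%:R).
  apply: le_trans (E_ge_density dw k0_gt0 NI k0k _ _ F); rewrite ler_pM2l//.
  apply: le_trans (Hd1 _ _ _ 0 F f0) _; rewrite add0r.
  apply: le_Int_itv => //; first exact: locint_density F.
  by move=> x; exact: density_ge0.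
have : M + J.+1%:R^-1 <= M + z / 3 by rewrite lerD2l.
move: (J.+1%:R^-1) => w; lra.
Qed.

Lemma limit_limits : (forall x, `|v' x| <= B) ->
  (forall a b, a <= b -> Int a b (density W v l) <= C) -> limits_pm1 v.
Proof.
move=> vB vC; have abs := abs_cvg_well HV vB vC; have cv := H2_cont HV.
have R1 : v x @[x --> +oo] --> (1 : R).
  apply/cvgrPdist_le => e e0; have [X HX] := abs e e0.
  near=> x; have x0 : 0 <= x by near: x; apply: nbhs_pinfty_ge; exact: num_real.
  rewrite distrC -[v x]ger0_norm ?limit_ge0//; apply: HX.
  by rewrite ger0_norm//; near: x; apply: nbhs_pinfty_ge; exact: num_real.
split => //; have h2 : 0 < 2^-1 :> R by rewrite invr_gt0.
have [X HX] := abs _ h2.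
pose Y := - (`|X| + 1).
have far x : x <= Y -> X <= `|x|.
  by have := ler_norm X; have := ler_norm (- x); rewrite normrN /Y; lra.
have v0 x : x <= Y -> v x != 0.
  move=> /far/HX; apply: contraTneq => ->.
  by rewrite normr0 sub0r normrN1 -ltNge; lra.
have sgn x : x <= Y -> (0 < v x) = (0 < v Y).
  by move=> xY; apply: same_sign => // y /andP[_]; exact: v0.
have [vY|vY] := ltP 0 (v Y).
  exfalso; apply: not_left_one => e e0; have [X' HX'] := abs e e0.
  exists (Num.min Y (- X')) => x; rewrite le_min => /andP[xY xX'].
  have vx : 0 < v x by rewrite sgn.
  have := HX' x; rewrite (gtr0_norm vx); apply.
  by have := ler_norm (- x); rewrite normrN; lra.
apply/cvgrPdist_le => e e0; have [X' HX'] := abs e e0.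
near=> x; have xY : x <= Y by near: x; apply: nbhs_ninfty_le; exact: num_real.
have vx : v x <= 0 by rewrite leNgt sgn// -leNgt.
have := HX' x; rewrite (ler0_norm vx) => H; rewrite addrC.
apply: H.
have : x <= - X' by near: x; apply: nbhs_ninfty_le; exact: num_real.
by have := ler_norm (- x); rewrite normrN; lra.
Unshelve. all: by end_near. Qed.

End Sequence.

Lemma minimizer_exists M : (m_ W k = M%:E)%E -> exists v v' l,
  [/\ H2 v v' l, limits_pm1 v & (energy W k v v' l <= M%:E)%E].
Proof.
move=> mM.
have [C [B [f [g [h [v [v' [Happ HC HB Hcv]]]]]]]] := minimizing_sequence dw k0_gt0 NI k0k mM.
have HH j : H2 (f j) (g j) (h j) by case: (Happ j).
have cauchy := L2_cauchy dw k0_gt0 NI k0k mM Happ HB Hcv.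
have [l [ll Hl]] := L2loc_complete (fun j => H2_L2 (HH j)) cauchy.
have HV := limit_H2 Happ Hcv ll Hl.
have EM := limit_E dw k0k Happ HC HB Hcv ll HV Hl.
have eM : (energy W k v v' l <= M%:E)%E.
  by apply: (energy_le dw k0_gt0 NI k0k HV); exists 0%N => n _; exact: EM.
exists v, v', l; split => //.
have Eab a b : a <= b -> E v v' l a b <= M.
  move=> ab; rewrite -lee_fin.
  by apply: le_trans (energy_ge dw k0_gt0 NI k0k HV ab) eM.
have Dab := density_bound dw k0_gt0 NI k0k HV Eab.
have vB x : `|v' x| <= B + 1.
  apply/ler_addgt0Pr => e e0.
  have [J HJ] := small_invS (Num.truncn `|x|).+1 e0.
  have [Jx Je] := HJ J (leqnn J).
  have xJ : `|x| <= J%:R.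
    by apply: le_trans (ltW (truncnS_gt _)) _; rewrite ler_nat.
  have [_ /le_trans/(_ Je)] := Hcv _ _ xJ; have := HB J x.
  by rewrite !ler_norml; lra.
exact: (limit_limits mM Happ Hcv HV vB Dab).
Qed.

End LimitsAtInfinity.

Theorem proposition3p6 (R : realType) (W : R -> R) (k0 : R) :
  double_well W -> 0 < k0 -> interpolation_ineq W k0 ->
  forall k : R, 0 < k < k0 ->
    (0 < m_ W k < +oo)%E /\
    is_minimum (energies W k limits_pm1) (m_ W k).
Proof.
move=> dw k0_gt0 NI k k0k.
have mgt := m_gt0 dw k0_gt0 NI k0k; have mlt := m_lty dw k0_gt0 NI k0k.
split; first by rewrite mgt.
have lb : lbound (energies W k limits_pm1) (m_ W k).
  move=> _ [f [f1 [f2 [Hf lf ->]]]].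
  have [g F ->] := W22loc_normal_form k dw Hf.
  exact: (m_le_energy_limits dw k0_gt0 NI k0k F lf).
split => //.
have mfin : m_ W k \is a fin_num by rewrite ge0_fin_numE// ltW.
have mM : m_ W k = (fine (m_ W k))%:E by rewrite fineK.
have [v [v' [l [HV Lv Ev]]]] := minimizer_exists dw k0_gt0 NI k0k mM.
exists v, v', l; split => //; first exact: H2_W22loc.
apply/eqP; rewrite eq_le mM Ev andbT -mM; apply: lb.
by exists v, v', l; split => //; exact: H2_W22loc.
Qed.
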